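(* For every integer $m\ge1$, all real $A>C>0$, every $D>0$, and all $p,q\in\mathbb R$ satisfying $p\ne0$, $q\ne0$, $p^2+q^2<1$, the metric $$g=g_{A,C}+g_{S^3}+p(\beta_1\otimes\sigma_1+\sigma_1\otimes\beta_1)+q(\beta_3\otimes\sigma_1+\sigma_1\otimes\beta_3)$$ on $S^{4m-1}\times S^3$ carries a one-dimensional totally geodesic foliation by closed circles with positive mixed sectional curvature, namely the foliation generated by $T=u_1$. The leaves have length $\ell_{\mathrm{leaf}}=\dfrac{4\pi}{\sqrt{AC}}$.
   Context: Mixed sectional curvature: the sectional curvature of 2-planes spanned by a vector tangent to the foliation and a vector orthogonal to it. A foliation is totally geodesic if its leaves are totally geodesic submanifolds. Notation. Let $g_0$ be the round metric of curvature $1$ on the unit sphere $S^{4m-1}\subset\mathbb H^m$, with $\xi_1(x)=xi$, $\xi_2(x)=xj$, $\xi_3(x)=xk$ and $\eta_\alpha=g_0(\xi_\alpha,\cdot)$. Put $L=2/\sqrt{AC}$, $M=2/A$, $g_{A,C}=L^2g_0+(M^2-L^2)\eta_2\otimes\eta_2$. The fields $u_1=\frac{\sqrt{AC}}2\xi_1$, $u_2=\frac A2\xi_2$, $u_3=\frac{\sqrt{AC}}2\xi_3$ are $g_{A,C}$-orthonormal and satisfy $[u_1,u_2]=Au_3$, $[u_2,u_3]=Au_1$, $[u_3,u_1]=Cu_2$; put $\beta_\alpha=g_{A,C}(u_\alpha,\cdot)$. Identify $S^3$ with the group $Sp(1)$ of unit quaternions, with the bi-invariant metric $g_{S^3}$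 for which the left-invariant frame $v_1,v_2,v_3$, whose values at the identity are positive multiples of $i,j,k$ respectively, is orthonormal and satisfies $[v_1,v_2]=Dv_3$, $[v_2,v_3]=Dv_1$, $[v_3,v_1]=Dv_2$; put $\sigma_1=g_{S^3}(v_1,\cdot)$. Fields, forms and metrics on the factors are pulled back to $S^{4m-1}\times S^3$ without change of notation. *)

(* Defs.v *)
From HB Require Import structures.
From mathcomp Require Import all_boot all_order all_algebra.
From mathcomp Require Import all_classical all_reals all_analysis.
From mathcomp Require Import ring.

Set Implicit Arguments.
Unset Strict Implicit.
Unset Printing Implicit Defensive.

Import Order.TTheory GRing.Theory Num.Theory numFieldNormedType.Exports.

Local Open Scope classical_set_scope.
Local Open Scope ring_scope.

(* MathComp-Analysis.

   Riemannian geometry of a closed submanifold [M] of a finite-dimensional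
   space [V], with tangent spaces [TM x].  Functions, vector fields and metrics
   on [M] are represented by (non-unique) extensions to [V]: every smooth
   function on [M] is the restriction of a smooth function on [V].  All
   identities are only required at the points of [M], and functions are only
   differentiated at points of [M] in directions tangent to [M], so the choice
   of the extensions is immaterial. *)

(* C^infinity: all iterated directional derivatives are differentiable. *)
Definition smooth (R : realType) (V W : normedModType R) (f : V -> W) : Prop :=
  forall (vs : seq V) (x : V),
    differentiable (foldr (fun v (h : V -> W) => (fun y => 'D_v h y)) f vs) x.

Section Submanifold.
Context {R : realType} {V : normedModType R}.
Variables (M : set V) (TM : V -> set V).
Implicit Types (X Y Z T : V -> V) (f : V -> R) (x y : V).

Definition vector_field X : Prop :=
  smooth X /\ forall x, M x -> TM x (X x).

Definition bracket X Y : V -> V := fun x => 'D_(X x) Y x - 'D_(Y x) X x.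

Definition riemannian_metric (g : V -> V -> V -> R) : Prop :=
  [/\ forall x, M x -> forall v w, TM x v -> TM x w -> g x v w = g x w v,
      forall x, M x -> forall (a : R) v v' w, TM x v -> TM x v' -> TM x w ->
        g x (a *: v + v') w = a * g x v w + g x v' w,
      forall x, M x -> forall v, TM x v -> v != 0 -> 0 < g x v v
    & forall X Y, vector_field X -> vector_field Y ->
        smooth (fun x => g x (X x) (Y x))].

Definition affine_connection (nabla : (V -> V) -> (V -> V) -> V -> V) : Prop :=
  [/\ forall X Y, vector_field X -> vector_field Y -> vector_field (nabla X Y),
      (* [nabla] is well defined on fields on [M] *)
      forall X X' Y Y', vector_field X -> vector_field X' ->
        vector_field Y -> vector_field Y' ->
        (forall x, M x -> X x = X' x) -> (forall x, M x -> Y x = Y' x) ->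
        forall x, M x -> nabla X Y x = nabla X' Y' x,
      forall f X X' Y, smooth f -> vector_field X -> vector_field X' ->
        vector_field Y -> forall x, M x ->
        nabla (fun y => f y *: X y + X' y) Y x
          = f x *: nabla X Y x + nabla X' Y x,
      forall X Y Y', vector_field X -> vector_field Y -> vector_field Y' ->
        forall x, M x ->
        nabla X (fun y => Y y + Y' y) x = nabla X Y x + nabla X Y' x
    & forall f X Y, smooth f -> vector_field X -> vector_field Y ->
        forall x, M x ->
        nabla X (fun y => f y *: Y y) x
          = 'D_(X x) f x *: Y x + f x *: nabla X Y x].

Definition levi_civita (g : V -> V -> V -> R)
    (nabla : (V -> V) -> (V -> V) -> V -> V) : Prop :=
  [/\ affine_connection nabla,
      forall X Y, vector_field X -> vector_field Y -> forall x, M x ->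
        nabla X Y x - nabla Y X x = bracket X Y x
    & forall X Y Z, vector_field X -> vector_field Y -> vector_field Z ->
        forall x, M x ->
        'D_(X x) (fun y => g y (Y y) (Z y)) x
          = g x (nabla X Y x) (Z x) + g x (Y x) (nabla X Z x)].

Definition curvature (nabla : (V -> V) -> (V -> V) -> V -> V) X Y Z : V -> V :=
  fun x => nabla X (nabla Y Z) x - nabla Y (nabla X Z) x
           - nabla (bracket X Y) Z x.

(* The sectional curvature of the plane spanned by [X x] and [Y x]; its value
   does not depend on the fields chosen to extend two given vectors. *)
Definition sectional_curvature (g : V -> V -> V -> R)
    (nabla : (V -> V) -> (V -> V) -> V -> V) X Y (x : V) : R :=
  g x (curvature nabla X Y Y x) (X x)
  / (g x (X x) (X x) * g x (Y x) (Y x) - g x (X x) (Y x) ^+ 2).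

(* An embedded submanifold [L] of [M] with tangent spaces [TL y]: its second
   fundamental form vanishes. *)
Definition totally_geodesic_submanifold
    (nabla : (V -> V) -> (V -> V) -> V -> V)
    (L : set V) (TL : V -> set V) : Prop :=
  forall X Y, vector_field X -> vector_field Y ->
    (forall y, L y -> TL y (X y)) -> (forall y, L y -> TL y (Y y)) ->
    forall x, L x -> TL x (nabla X Y x).

Definition integral_curve T (c : R -> V) : Prop :=
  forall t : R, M (c t) /\ is_derive t 1 c (T (c t)).

(* The leaf through [x] of the foliation generated by [T].  On a compact
   manifold the maximal integral curves are defined on the whole line. *)
Definition leaf T x : set V :=
  [set y | exists (c : R -> V) (t : R),
     [/\ integral_curve T c, c 0 = x & c t = y]].

Definition leaf_tangent T x : set V := [set v | exists a : R, v = a *: T x].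

Definition generates_foliation T : Prop :=
  [/\ vector_field T,
      forall x, M x -> T x != 0,
      forall x, M x -> leaf T x x
    & forall x y, M x -> leaf T x y -> leaf T y = leaf T x].

Definition totally_geodesic_foliation
    (nabla : (V -> V) -> (V -> V) -> V -> V) T : Prop :=
  forall x, M x ->
    totally_geodesic_submanifold nabla (leaf T x) (leaf_tangent T).

Definition positive_mixed_curvature (g : V -> V -> V -> R)
    (nabla : (V -> V) -> (V -> V) -> V -> V) T : Prop :=
  forall X Y x, vector_field X -> vector_field Y -> M x ->
    leaf_tangent T x (X x) -> X x != 0 ->
    g x (T x) (Y x) = 0 -> Y x != 0 ->
    0 < sectional_curvature g nabla X Y x.

(* [L] is a smoothly embedded circle, parametrized by [c] with period [w]. *)
Definition closed_circle (L : set V) (c : R -> V) (w : R) : Prop :=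
  [/\ 0 < w /\ smooth c,
      forall t, c (t + w) = c t,
      {in `[0, w[ &, injective c},
      forall t, derive1 c t != 0
    & range c = L].

Definition circle_length (g : V -> V -> V -> R) (c : R -> V) (w : R) : R :=
  \int[lebesgue_measure]_(t in `[0, w])
    Num.sqrt (g (c t) (derive1 c t) (derive1 c t)).

End Submanifold.

Section Quaternions.
Context {R : realType}.

(* A matrix in ['M_(m, 4)] is a vector of [H^m]: its rows are the quaternions
   a + b i + c j + d k.  [qmul x a] is the right multiplication of every row of
   [x] by the quaternion [a]; for [m = 1] it is the product of quaternions. *)
Definition qmul m (x : 'M[R]_(m, 4)) (a : 'rV[R]_4) : 'M[R]_(m, 4) :=
  \matrix_(r, s)
    [:: x r 0 * a 0 0 - x r 1 * a 0 1 - x r 2 * a 0 2 - x r 3 * a 0 3;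
        x r 0 * a 0 1 + x r 1 * a 0 0 + x r 2 * a 0 3 - x r 3 * a 0 2;
        x r 0 * a 0 2 - x r 1 * a 0 3 + x r 2 * a 0 0 + x r 3 * a 0 1;
        x r 0 * a 0 3 + x r 1 * a 0 2 - x r 2 * a 0 1 + x r 3 * a 0 0]`_s.

Definition qi : 'rV[R]_4 := delta_mx 0 1.
Definition qj : 'rV[R]_4 := delta_mx 0 2.
Definition qk : 'rV[R]_4 := delta_mx 0 3.

Definition dot m (x y : 'M[R]_(m, 4)) : R := \sum_r \sum_s x r s * y r s.

Definition sphere m : set 'M[R]_(m, 4) := [set x | dot x x = 1].

Definition sphere_tangent m (x : 'M[R]_(m, 4)) : set 'M[R]_(m, 4) :=
  [set v | dot x v = 0].

(* [a] = [qi], [qj], [qk] gives the fields xi_1, xi_2, xi_3. *)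
Definition xi m (a : 'rV[R]_4) (x : 'M[R]_(m, 4)) : 'M[R]_(m, 4) := qmul x a.

Definition eta m (a : 'rV[R]_4) (x v : 'M[R]_(m, 4)) : R := dot (xi a x) v.

Definition u1 m (A C : R) (x : 'M[R]_(m, 4)) := (Num.sqrt (A * C) / 2) *: xi qi x.
Definition u2 m (A : R) (x : 'M[R]_(m, 4)) := (A / 2) *: xi qj x.
Definition u3 m (A C : R) (x : 'M[R]_(m, 4)) := (Num.sqrt (A * C) / 2) *: xi qk x.

Definition gAC m (A C : R) (x v w : 'M[R]_(m, 4)) : R :=
  let L := 2 / Num.sqrt (A * C) in
  let M := 2 / A in
  L ^+ 2 * dot v w + (M ^+ 2 - L ^+ 2) * (eta qj x v * eta qj x w).

Definition beta1 m (A C : R) (x v : 'M[R]_(m, 4)) : R := gAC A C x (u1 A C x) v.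
Definition beta3 m (A C : R) (x v : 'M[R]_(m, 4)) : R := gAC A C x (u3 A C x) v.

(* The left-invariant field on the unit quaternions with value [(D / 2) a] at
   the identity.  On [S^3] the fields [y i], [y j], [y k] have brackets
   [y i, y j] = 2 y k and so on, whence the factor [D / 2]; see
   [v_frame_unique] and [v_bracket]. *)
Definition vfield (D : R) (a y : 'rV[R]_4) : 'rV[R]_4 := qmul y ((D / 2) *: a).

(* The multiple of the round metric for which the [vfield]s of [qi], [qj], [qk]
   are orthonormal; see [vfield_orthonormal] and [gS3_biinvariant]. *)
Definition gS3 (D : R) (v w : 'rV[R]_4) : R := (2 / D) ^+ 2 * dot v w.

Definition sigma1 (D : R) (y w : 'rV[R]_4) : R := gS3 D (vfield D qi y) w.

Definition prodM m : set ('M[R]_(m, 4) * 'rV[R]_4) :=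
  [set z | sphere z.1 /\ sphere z.2].

Definition prodTM m (z : 'M[R]_(m, 4) * 'rV[R]_4) :
    set ('M[R]_(m, 4) * 'rV[R]_4) :=
  [set v | sphere_tangent z.1 v.1 /\ sphere_tangent z.2 v.2].

Definition metric m (A C D p q : R) (z v w : 'M[R]_(m, 4) * 'rV[R]_4) : R :=
  let b1 (t : 'M[R]_(m, 4) * 'rV[R]_4) := beta1 A C z.1 t.1 in
  let b3 (t : 'M[R]_(m, 4) * 'rV[R]_4) := beta3 A C z.1 t.1 in
  let s1 (t : 'M[R]_(m, 4) * 'rV[R]_4) := sigma1 D z.2 t.2 in
  gAC A C z.1 v.1 w.1 + gS3 D v.2 w.2
  + p * (b1 v * s1 w + s1 v * b1 w)
  + q * (b3 v * s1 w + s1 v * b3 w).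

Definition fieldT m (A C : R) (z : 'M[R]_(m, 4) * 'rV[R]_4) :
    'M[R]_(m, 4) * 'rV[R]_4 := (u1 A C z.1, 0).

End Quaternions.

Section Checks.
Context {R : realType}.

Lemma derive_linear (V W : normedModType R) (f : V -> W) (v x : V) :
  (forall a u w, f (a *: u + w) = a *: f u + f w) -> 'D_v f x = f v.
Proof.
move=> fl; rewrite /derive; apply: cvg_lim => //.
apply: (@cvg_near_cst _ _ (f v)).
near=> h; have h0 : h != 0 by near: h; exact: nbhs_dnbhs_neq.
by rewrite /= fl addrK scalerA mulVf // scale1r.
Unshelve. all: by end_near. Qed.

Lemma forall_I4 (P : 'I_4 -> Prop) : P 0 -> P 1 -> P 2 -> P 3 -> forall s, P s.
Proof.
move=> P0 P1 P2 P3 [[|[|[|[|//]]]] lt_s4].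
- by rewrite (_ : Ordinal _ = 0) //; exact: val_inj.
- by rewrite (_ : Ordinal _ = 1) //; exact: val_inj.
- by rewrite (_ : Ordinal _ = 2) //; exact: val_inj.
- by rewrite (_ : Ordinal _ = 3) //; exact: val_inj.
Qed.

Lemma qmul_linear m (c : R) (a : 'rV[R]_4) (u w : 'M[R]_(m, 4)) :
  qmul (c *: u + w) a = c *: qmul u a + qmul w a.
Proof.
apply/matrixP => r; apply: forall_I4; rewrite !mxE /=; ring.
Qed.

Lemma qmulZr m (c : R) (a : 'rV[R]_4) (y : 'M[R]_(m, 4)) :
  qmul y (c *: a) = c *: qmul y a.
Proof.
apply/matrixP => r; apply: forall_I4; rewrite !mxE /=; ring.
Qed.

Lemma qmulZl m (c : R) (a : 'rV[R]_4) (y : 'M[R]_(m, 4)) :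
  qmul (c *: y) a = c *: qmul y a.
Proof.
apply/matrixP => r; apply: forall_I4; rewrite !mxE /=; ring.
Qed.

Lemma bracket_qmul m (c d : R) (a b : 'rV[R]_4) (x : 'M[R]_(m, 4)) :
  bracket (fun y => c *: qmul y a) (fun y => d *: qmul y b) x
  = (c * d) *: (qmul (qmul x a) b - qmul (qmul x b) a).
Proof.
rewrite /bracket !derive_linear.
- by rewrite !qmulZl !scalerA scalerBr (mulrC d).
- by move=> *; rewrite qmul_linear scalerDr !scalerA mulrC.
- by move=> *; rewrite qmul_linear scalerDr !scalerA mulrC.
Qed.

Lemma qij m (x : 'M[R]_(m, 4)) :
  qmul (qmul x qi) qj - qmul (qmul x qj) qi = 2 *: qmul x qk.
Proof. by apply/matrixP => r; apply: forall_I4; rewrite !mxE /=; ring. Qed.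

Lemma qjk m (x : 'M[R]_(m, 4)) :
  qmul (qmul x qj) qk - qmul (qmul x qk) qj = 2 *: qmul x qi.
Proof. by apply/matrixP => r; apply: forall_I4; rewrite !mxE /=; ring. Qed.

Lemma qki m (x : 'M[R]_(m, 4)) :
  qmul (qmul x qk) qi - qmul (qmul x qi) qk = 2 *: qmul x qj.
Proof. by apply/matrixP => r; apply: forall_I4; rewrite !mxE /=; ring. Qed.

Lemma u_bracket m (A C : R) (x : 'M[R]_(m, 4)) : 0 < A -> 0 < C ->
  [/\ bracket (u1 A C) (u2 A) x = A *: u3 A C x,
      bracket (u2 A) (u3 A C) x = A *: u1 A C x
    & bracket (u3 A C) (u1 A C) x = C *: u2 A x].
Proof.
move=> A0 C0; have AC : Num.sqrt (A * C) ^+ 2 = A * C.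
  by rewrite sqr_sqrtr // mulr_ge0 // ltW.
rewrite /u1 /u2 /u3 /xi !bracket_qmul qij qjk qki !scalerA.
split; congr (_ *: _); [by field|by field|].
by transitivity (Num.sqrt (A * C) ^+ 2 / 2); [field|rewrite AC; field].
Qed.

Lemma dotE m (x y : 'M[R]_(m, 4)) : dot x y =
  \sum_r (x r 0 * y r 0 + x r 1 * y r 1 + x r 2 * y r 2 + x r 3 * y r 3).
Proof.
apply: eq_bigr => r _; rewrite !big_ord_recl big_ord0 addr0 !addrA.
by do !congr (_ + _); do ?[congr (x r _ * y r _); exact: val_inj].
Qed.

Lemma dotZ m (c d : R) (x y : 'M[R]_(m, 4)) :
  dot (c *: x) (d *: y) = c * d * dot x y.
Proof.
rewrite !dotE mulr_sumr; apply: eq_bigr => r _; rewrite !mxE; ring.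
Qed.

Lemma dot_qmul m (a b : 'rV[R]_4) (x : 'M[R]_(m, 4)) :
  dot (qmul x a) (qmul x b) = dot x x * dot a b.
Proof.
rewrite !dotE big_ord1 mulr_suml; apply: eq_bigr => r _.
rewrite !mxE /=; ring.
Qed.

Lemma dot_units :
  [/\ dot qi qi = 1 :> R, dot qj qj = 1 :> R, dot qk qk = 1 :> R,
      dot qi qj = 0 :> R & dot qi qk = 0 :> R] /\ dot qj qk = 0 :> R.
Proof. by do !split; rewrite !dotE big_ord1 !mxE /=; ring. Qed.

Lemma u_orthonormal m (A C : R) (x : 'M[R]_(m, 4)) :
    0 < A -> 0 < C -> sphere x ->
  [/\ gAC A C x (u1 A C x) (u1 A C x) = 1, gAC A C x (u2 A x) (u2 A x) = 1,
      gAC A C x (u3 A C x) (u3 A C x) = 1, gAC A C x (u1 A C x) (u2 A x) = 0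
    & gAC A C x (u1 A C x) (u3 A C x) = 0] /\
  gAC A C x (u2 A x) (u3 A C x) = 0.
Proof.
move=> A0 C0 x1; have AC : Num.sqrt (A * C) != 0.
  by rewrite gt_eqF // sqrtr_gt0 mulr_gt0.
have An0 : A != 0 by rewrite gt_eqF.
have dC (a b : 'rV[R]_4) : dot a b = dot b a.
  by apply: eq_bigr => r _; apply: eq_bigr => s _; rewrite mulrC.
have [[ii jj kk ij ik] jk] := dot_units.
have eZ (c : R) a y : eta qj y (c *: qmul y a) = c * eta qj y (qmul y a) :> R.
  by rewrite /eta !dotE mulr_sumr; apply: eq_bigr => r _; rewrite [(c *: qmul y a) _ 0]mxE [(c *: qmul y a) _ 1]mxE [(c *: qmul y a) _ 2]mxE [(c *: qmul y a) _ 3]mxE; ring.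
rewrite /gAC /u1 /u2 /u3 !dotZ !eZ /eta /xi !dot_qmul x1.
rewrite (dC qj qi) ii jj kk ij ik jk.
by do !split; field; rewrite ?AC ?An0.
Qed.

Lemma v_bracket (D : R) (y : 'rV[R]_4) :
  [/\ bracket (vfield D qi) (vfield D qj) y = D *: vfield D qk y,
      bracket (vfield D qj) (vfield D qk) y = D *: vfield D qi y
    & bracket (vfield D qk) (vfield D qi) y = D *: vfield D qj y].
Proof.
have vE a : vfield D a = fun y => (D / 2) *: qmul y a.
  by apply/funext => z; exact: qmulZr.
rewrite !vE !bracket_qmul qij qjk qki !scalerA.
by split; congr (_ *: _); field.
Qed.

Lemma v_frame_unique (D a b c : R) (y : 'rV[R]_4) :
    0 < D -> 0 < a -> 0 < b -> 0 < c -> sphere y ->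
    bracket (fun y => a *: qmul y qi) (fun y => b *: qmul y qj) y
      = D *: (c *: qmul y qk) ->
    bracket (fun y => b *: qmul y qj) (fun y => c *: qmul y qk) y
      = D *: (a *: qmul y qi) ->
    bracket (fun y => c *: qmul y qk) (fun y => a *: qmul y qi) y
      = D *: (b *: qmul y qj) ->
  [/\ a = D / 2, b = D / 2 & c = D / 2].
Proof.
move=> D0 a0 b0 c0 y1; rewrite !bracket_qmul qij qjk qki !scalerA.
have [[ii jj kk _ _] _] := dot_units.
have inj (s t : R) (e : 'rV[R]_4) : dot e e = 1 ->
    s *: qmul y e = t *: qmul y e -> s = t.
  move=> e1 /(congr1 (dot (1 *: qmul y e))).
  by rewrite !dotZ !dot_qmul y1 e1 !mul1r !mulr1.
move=> /(inj _ _ _ kk) abc /(inj _ _ _ ii) bca /(inj _ _ _ jj) cab.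
have half (s t u : R) : 0 < s -> 0 < t -> s * t * 2 = D * u ->
    u * s * 2 = D * t -> s = D / 2.
  move=> s0 t0 st us.
  have /eqP : (s * 2 - D) * (s * 2 + D) * t = 0.
    transitivity (2 * s * (s * t * 2) - D * (D * t)); first by ring.
    by rewrite st -us; ring.
  rewrite !mulf_eq0 (gt_eqF t0) orbF subr_eq0.
  rewrite [X in _ || X]gt_eqF ?orbF; last by rewrite addr_gt0 // mulr_gt0.
  by move=> /eqP <-; rewrite mulfK.
split; [exact: half abc cab|exact: half bca abc|exact: half cab bca].
Qed.

Lemma vfield_left_invariant (D : R) (a b y : 'rV[R]_4) :
  vfield D a (qmul b y) = qmul b (vfield D a y).
Proof. by apply/matrixP => r; apply: forall_I4; rewrite !mxE /= !(ord1 r); ring. Qed.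

Lemma vfield_orthonormal (D : R) (y : 'rV[R]_4) : 0 < D -> sphere y ->
  let v a := vfield D a y in
  [/\ gS3 D (v qi) (v qi) = 1, gS3 D (v qj) (v qj) = 1,
      gS3 D (v qk) (v qk) = 1, gS3 D (v qi) (v qj) = 0
    & gS3 D (v qi) (v qk) = 0] /\ gS3 D (v qj) (v qk) = 0.
Proof.
move=> D0 y1 /=; have Dn0 : D != 0 by rewrite gt_eqF.
have [[ii jj kk ij ik] jk] := dot_units.
rewrite /gS3 /vfield !qmulZr !dotZ !dot_qmul y1 ii jj kk ij ik jk.
by do !split; field; rewrite ?Dn0.
Qed.

Lemma gS3_biinvariant (D : R) (a v w : 'rV[R]_4) : sphere a ->
  gS3 D (qmul a v) (qmul a w) = gS3 D v w /\
  gS3 D (qmul v a) (qmul w a) = gS3 D v w.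
Proof.
move=> a1; rewrite /gS3 dot_qmul a1 mul1r; split=> //; congr (_ * _).
transitivity (dot a a * dot v w); last by rewrite a1 mul1r.
by rewrite !dotE !big_ord1 !mxE /=; ring.
Qed.

End Checks.

(* Main.v *)
(* Write [L = 2 / sqrt (A C)], [M = 2 / A].  The field [T = u_1] is a unit
   geodesic field, whose integral curves are the circles [x e^(it/L)].  Hence
   [nabla T] alone determines the mixed curvature: for [Y] orthogonal to [T],
     [g (R(T,Y)Y, T) = |nabla_Y T|^2 - 1/2 (L_T L_T g)(Y, Y)].
   By the Koszul formula [g (nabla_Y T, Z)] is an explicit bilinear form, so
   that [|nabla_Y T|^2 >= 2 g (nabla_Y T, z) - g (z, z)] can be evaluated for an
   explicit tangent vector [z].  With [Y = b2 u_2 + b3 u_3 + ...], [X] the part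
   of [Y] orthogonal to the quaternionic lines and [s1, s2, s3] its components
   along the [v_a], the outcome is a sum of squares
     [AC/4 |X|^2 + p^2 D^2 / 4 (s2^2 + s3^2) + C^2/4 b2^2
      + 1/4 (C b3 + q A s1)^2 + C (A - C) b3^2],
   which can only vanish, as [p] and [q] are nonzero, if [Y] is a multiple of
   [T]. *)
From HB Require Import structures.
From mathcomp Require Import all_boot all_order all_algebra.
From mathcomp Require Import all_classical all_reals all_analysis.
From mathcomp Require Import ring lra.
Require Import Defs.
Import Order.TTheory GRing.Theory Num.Theory numFieldNormedType.Exports.
Local Open Scope classical_set_scope.
Local Open Scope ring_scope.

Set Implicit Arguments.
Unset Strict Implicit.
Unset Printing Implicit Defensive.

(** * Smooth functions *)

Section SmoothCalculus.
Context {R : realType}.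
Implicit Types U V W : normedModType R.

(** Since fields and functions are extended to [V], an identity is known only on [M] and may be
    differentiated only in tangent directions. The connection is any one satisfying the axioms, so
    everything must be extracted from compatibility with the metric and vanishing torsion. The field
    [X] of a mixed plane is proportional to [T] only at the given point; the curvature is therefore
    shown to be tensorial in its first argument before [T] replaces [X]. The inequality for |nabla_Y
    T|^2 spares an inversion of g: on the span of u_1, u_3, v_1 the metric is not diagonal, and the
    exact norm would carry the denominator 1 - p^2 - q^2. Choosing z without a v_1-component loses
    only a non-negative multiple of the squared u_2-component of Y, and what is left still controls
    that component. *)

Fixpoint differentiable_upto n V W (f : V -> W) : Prop :=
  (forall x, differentiable f x) /\
  (if n is n'.+1 then forall v, differentiable_upto n' (fun y => 'D_v f y) else True).

(** The last direction of the list is the innermost derivative. Peeling it off turns the list form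
    into a recursion on the order, and closure properties of smooth functions then follow by
    induction on the order. *)
Lemma smoothP V W (f : V -> W) : smooth f <-> forall n, differentiable_upto n f.
Proof.
split=> [sf n|sf vs x].
  elim: n f sf => [|n IH] f sf; (split; first by move=> x; exact: (sf [::])) => // v.
  by apply: IH => vs x; have := sf (rcons vs v) x; rewrite foldr_rcons.
elim/last_ind: vs f sf x => [|vs v IH] f sf x; first exact: (sf 0%N).1.
by rewrite foldr_rcons; apply: IH => n; have [_] := sf n.+1; apply.
Qed.

Lemma smooth_differentiable V W (f : V -> W) x : smooth f -> differentiable f x.
Proof. by move=> /(_ [::]). Qed.

Lemma smooth_derivable V W (f : V -> W) x v : smooth f -> derivable f x v.
Proof. by move=> sf; apply/diff_derivable/smooth_differentiable. Qed.

Lemma smooth_derive V W (f : V -> W) v : smooth f -> smooth (fun x => 'D_v f x).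
Proof. by move=> sf vs x; have := sf (rcons vs v) x; rewrite foldr_rcons. Qed.

Lemma smoothI V W (f : V -> W) : (forall x, differentiable f x) ->
  (forall v, smooth (fun x => 'D_v f x)) -> smooth f.
Proof.
move=> df sf; apply/smoothP => -[|n]; split=> // v.
by move: n; apply/smoothP.
Qed.

Lemma differentiable_uptoW n V W (f : V -> W) :
  differentiable_upto n.+1 f -> differentiable_upto n f.
Proof.
elim: n V W f => [|n IH] V W f [df sf]; first by split.
by split=> // v; apply/IH/sf.
Qed.

Lemma eq_differentiable_upto n V W (f g : V -> W) :
  f =1 g -> differentiable_upto n g -> differentiable_upto n f.
Proof. by move=> /funext ->. Qed.

Lemma eq_smooth V W (f g : V -> W) : f =1 g -> smooth g -> smooth f.
Proof. by move=> /funext ->. Qed.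

Lemma smooth_cst V W (a : W) : smooth (fun _ : V => a).
Proof.
apply/smoothP => n; elim: n a => [|n IH] a.
  by split=> // x; exact: differentiable_cst.
split=> [x|v]; first exact: differentiable_cst.
by apply: eq_differentiable_upto (IH 0) => y; exact: derive_cst.
Qed.

Lemma differentiable_uptoD n V W (f g : V -> W) :
  differentiable_upto n f -> differentiable_upto n g ->
  differentiable_upto n (fun x => f x + g x).
Proof.
elim: n f g => [|n IH] f g [df sf] [dg sg]; split=> //.
- by move=> x; apply: differentiableD.
- by move=> x; apply: differentiableD.
- move=> v; apply: eq_differentiable_upto (IH _ _ (sf v) (sg v)) => y.
  by rewrite deriveD //; apply: diff_derivable.
Qed.

Lemma smoothD V W (f g : V -> W) :
  smooth f -> smooth g -> smooth (fun x => f x + g x).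
Proof.
move=> /smoothP sf /smoothP sg; apply/smoothP => n; exact: differentiable_uptoD.
Qed.

Lemma derive_linear_comp U V W (L : {linear V -> W}) (f : U -> V) x v :
  continuous L -> differentiable f x -> 'D_v (fun y => L (f y)) x = L ('D_v f x).
Proof.
move=> cL df; have dL y : differentiable L y by exact: linear_differentiable.
rewrite deriveE; last exact: differentiable_comp.
by rewrite (diff_comp df (dL _)) /= diff_lin // deriveE.
Qed.

Lemma smooth_linear_comp U V W (L : {linear V -> W}) (f : U -> V) :
  continuous L -> smooth f -> smooth (fun x => L (f x)).
Proof.
move=> cL /smoothP sf; apply/smoothP => n.
have dL y : differentiable L y by exact: linear_differentiable.
have {}sf := sf n; elim: n f sf => [|n IH] f [df sf]; split=> //.
- by move=> x; apply: differentiable_comp.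
- by move=> x; apply: differentiable_comp.
- move=> v; apply: eq_differentiable_upto (IH _ (sf v)) => y.
  by rewrite derive_linear_comp.
Qed.

Lemma smoothN V W (f : V -> W) : smooth f -> smooth (fun x => - f x).
Proof.
move=> sf; apply: (@smooth_linear_comp _ _ _ (-%R : {linear W -> W})) => //.
exact: opp_continuous.
Qed.

Lemma smoothB V W (f g : V -> W) :
  smooth f -> smooth g -> smooth (fun x => f x - g x).
Proof. by move=> sf sg; apply: smoothD => //; apply: smoothN. Qed.

Lemma smooth_id V : smooth (fun x : V => x).
Proof.
apply: smoothI => [x|v]; first by have [] := is_diff_id x.
apply: eq_smooth (@smooth_cst _ _ v) => y.
exact: derive_id.
Qed.

Fact scale_is_bilinear W : bilinear_for
  (GRing.Scale.Law.clone _ _ *:%R _) (GRing.Scale.Law.clone _ _ *:%R _)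
  (@GRing.scale R W).
Proof.
split=> [u'|u] a x y /=.
- by rewrite scalerDl scalerA.
- by rewrite scalerDr !scalerA mulrC.
Qed.

(** The product is the continuous bilinear map [*:%R] composed with the pair of its factors. *)
Lemma is_diff_scale V W (k : V -> R) (f : V -> W) x :
  differentiable k x -> differentiable f x ->
  is_diff x (fun y => k y *: f y) (fun v => k x *: 'd f x v + 'd k x v *: f x).
Proof.
move=> dk df.
pose bM := bilinear_isBilinear.Build R R W W _ _ (@GRing.scale R W) (@scale_is_bilinear W).
pose b : {bilinear R -> W -> W} := HB.pack (@GRing.scale R W) bM.
have cb : continuous (fun p : R * W => b p.1 p.2).
  by move=> p; apply: cvgZ; [exact: cvg_fst|exact: cvg_snd].
have dp : differentiable (fun y => (k y, f y)) x by exact: differentiable_pair.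
have db := @differentiable_bilin _ _ _ _ b (k x, f x) cb.
rewrite (_ : (fun y => _) = (fun p : R * W => b p.1 p.2) \o (fun y => (k y, f y))) //.
apply: DiffDef; first exact: differentiable_comp.
rewrite diff_comp // diff_bilin // diff_pair //.
Qed.

Lemma deriveZ_fun V W (k : V -> R) (f : V -> W) x v :
  differentiable k x -> differentiable f x ->
  'D_v (fun y => k y *: f y) x = 'D_v k x *: f x + k x *: 'D_v f x.
Proof.
move=> dk df; have dkf := is_diff_scale dk df.
by rewrite !deriveE // (@diff_val _ _ _ _ _ _ _ dkf) addrC.
Qed.

Lemma smoothZ V W (k : V -> R) (f : V -> W) :
  smooth k -> smooth f -> smooth (fun x => k x *: f x).
Proof.
move=> /smoothP sk /smoothP sf; apply/smoothP => n.
have dkf (h : V -> R) (e : V -> W) : (forall x, differentiable h x) ->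
    (forall x, differentiable e x) -> forall x, differentiable (fun x => h x *: e x) x.
  by move=> dh de x; have [] := is_diff_scale (dh x) (de x).
have {}sk := sk n; have {}sf := sf n; elim: n k f sk sf => [|n IH] k f dk df.
  by split=> //; apply: dkf; [case: dk|case: df].
have [dk1 dk2] := dk; have [df1 df2] := df; split; first exact: dkf.
move=> v; apply: (@eq_differentiable_upto _ _ _ _
  (fun y => 'D_v k y *: f y + k y *: 'D_v f y)).
  by move=> y; rewrite deriveZ_fun.
(* Each term of the product rule pairs a derivative, known to order [n], with an undifferentiated
   factor, whose order is lowered to [n]. *)
by apply: differentiable_uptoD; apply: IH;
  do ?[exact: dk2|exact: df2|exact: (differentiable_uptoW dk)
      |exact: (differentiable_uptoW df)].
Qed.

Lemma smoothM V (k f : V -> R) :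
  smooth k -> smooth f -> smooth (fun x => k x * f x).
Proof. exact: (@smoothZ V R). Qed.

Lemma deriveM_fun V (k f : V -> R) x v :
  differentiable k x -> differentiable f x ->
  'D_v (fun y => k y * f y) x = 'D_v k x * f x + k x * 'D_v f x.
Proof. exact: (@deriveZ_fun V R). Qed.

Lemma deriveD_fun V W (f g : V -> W) x v :
  differentiable f x -> differentiable g x ->
  'D_v (fun y => f y + g y) x = 'D_v f x + 'D_v g x.
Proof. by move=> df dg; rewrite deriveD //; apply: diff_derivable. Qed.

Lemma smooth_sum V W (I : Type) (r : seq I) (f : I -> V -> W) :
  (forall i, smooth (f i)) -> smooth (fun x => \sum_(i <- r) f i x).
Proof.
move=> sf; elim: r => [|i r IH].
  by apply: eq_smooth (@smooth_cst _ _ 0) => x; rewrite big_nil.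
by apply: eq_smooth (smoothD (sf i) IH) => x; rewrite big_cons.
Qed.

Lemma derive_sum_fun V W (I : Type) (r : seq I) (f : I -> V -> W) x v :
  (forall i, differentiable (f i) x) ->
  'D_v (fun x => \sum_(i <- r) f i x) x = \sum_(i <- r) 'D_v (f i) x.
Proof.
move=> df; suff : differentiable (fun x => \sum_(i <- r) f i x) x /\
  'D_v (fun x => \sum_(i <- r) f i x) x = \sum_(i <- r) 'D_v (f i) x by case.
elim: r => [|i r [dr IH]].
  have -> : (fun x => \sum_(i <- [::]) f i x) = cst 0.
    by apply/funext => y; rewrite big_nil.
  by rewrite big_nil derive_cst; split.
have -> : (fun x => \sum_(j <- i :: r) f j x) =
    fun x => f i x + \sum_(j <- r) f j x.
  by apply/funext => y; rewrite big_cons.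
by rewrite big_cons deriveD_fun // IH; split => //; apply: differentiableD.
Qed.

End SmoothCalculus.

(** * Symmetry of mixed second derivatives *)

Section Schwarz.
Context {R : realType} {V : normedModType R}.
Implicit Types (f : V -> R) (v w x : V).

Lemma is_derive_line (W : normedModType R) (f : V -> W) x v (s : R) :
  derivable f (x + s *: v) v ->
  is_derive s 1 (fun t : R => f (x + t *: v)) ('D_v f (x + s *: v)).
Proof.
have E : (fun h => h^-1 *: (((fun t : R => f (x + t *: v)) \o shift s) (h *: (1 : R))
                            - f (x + s *: v)))
   = (fun h => h^-1 *: ((f \o shift (x + s *: v)) (h *: v) - f (x + s *: v))).
  apply/funext => h /=; congr (_ *: (f _ - _)).
  by rewrite [h%:A]mulr1 scalerDl addrCA.
move=> df; apply: DeriveDef; first by rewrite /derivable E.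
by rewrite /derive E.
Qed.

Lemma mean_value_line f x v (h : R) : (forall y, differentiable f y) -> 0 < h ->
  exists2 s, 0 < s < h & f (x + h *: v) - f x = h * 'D_v f (x + s *: v).
Proof.
move=> df h0; pose phi (t : R) := f (x + t *: v).
have dphi (s : R) : is_derive s 1 phi ('D_v f (x + s *: v)).
  by apply: is_derive_line; apply: diff_derivable.
have [|s /[!in_itv]/= sh] :=
  @MVT _ phi (fun s => 'D_v f (x + s *: v)) 0 h h0 (fun s _ => dphi s).
  apply: derivable_within_continuous => s _; exact: ex_derive.
rewrite /phi scale0r addr0 subr0 => E; exists s => //.
by rewrite E mulrC.
Qed.

(** The mean value theorem is applied twice: along [v] to the increment [G] of [f] in the direction
    [w], then along [w] to the derivative of [f] in the direction [v]. *)
Lemma second_difference f x v w (h : R) : smooth f -> 0 < h ->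
  exists s t, [/\ 0 < s < h, 0 < t < h &
    f (x + h *: v + h *: w) - f (x + h *: v) - (f (x + h *: w) - f x)
    = h ^+ 2 * 'D_w (fun y => 'D_v f y) (x + s *: v + t *: w)].
Proof.
move=> sf h0; pose G y := f (y + h *: w) - f y.
have dshift y : differentiable (fun y => f (y + h *: w)) y.
  apply: (@differentiable_comp _ _ _ _ (fun y => y + h *: w) f).
    by apply: differentiableD => //; have [] := is_diff_id y.
  exact: smooth_differentiable.
have dG y : differentiable G y.
  by apply: differentiableB => //; exact: smooth_differentiable.
have [s sh E] := mean_value_line x v dG h0.
have [t th E'] := mean_value_line (x + s *: v) w
  (fun y => smooth_differentiable y (smooth_derive v sf)) h0.
exists s, t; split=> //.
rewrite expr2 -mulrA -E'.
transitivity (G (x + h *: v) - G x); first by [].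
rewrite E; congr (_ * _).
rewrite [LHS]deriveB; last 2 first.
- exact/diff_derivable.
- exact: smooth_derivable.
congr (_ - _).
(* The derivative of a translate of [f] is the translate of its derivative. *)
rewrite /derive; congr (lim _).
suff -> : (fun h0 => h0^-1 *: (((fun y => f (y + h *: w)) \o shift (x + s *: v)) (h0 *: v)
                              - f (x + s *: v + h *: w)))
  = (fun h0 => h0^-1 *: ((f \o shift (x + s *: v + h *: w)) (h0 *: v)
                         - f (x + s *: v + h *: w))) by [].
by apply/funext => k /=; rewrite !addrA.
Qed.

Lemma distr_half_le (i j k l e : R) :
  `|i - j| < e / 2 -> `|k - l| < e / 2 -> j = l -> `|i - k| <= e.
Proof.
move=> ij kl jl; rewrite -(subrKA j) (le_trans (ler_normD _ _)) // (splitr e).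
by rewrite lerD // ltW // jl distrC.
Qed.

(* Schwarz: both mixed derivatives are limits of the same second difference
   quotient. *)
Lemma derive_comm f v w x : smooth f ->
  'D_w (fun y => 'D_v f y) x = 'D_v (fun y => 'D_w f y) x.
Proof.
move=> sf; set a := LHS; set b := RHS.
apply/eqP; rewrite -subr_eq0 -normr_le0; apply/ler_addgt0Pl => e e0; rewrite addr0.
have e2 : 0 < e / 2 by rewrite divr_gt0.
have near0 (g : V -> R) v' w' : smooth g -> exists2 d, 0 < d &
    forall s t, 0 < s < d -> 0 < t < d -> `|g x - g (x + s *: v' + t *: w')| < e / 2.
  move=> sg; have /cvgrPdist_lt/(_ _ e2) :=
    differentiable_continuous (smooth_differentiable x sg).
  move=> /nbhs_ballP[r /= r0 rP].
  (* The summand 1 keeps [k] positive when both directions vanish. *)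
  pose k := `|v'| + `|w'| + 1.
  have k0 : 0 < k by rewrite ltr_wpDl // addr_ge0.
  exists (r / k) => [|s t /andP[s0 sr] /andP[t0 tr]]; first by rewrite divr_gt0.
  apply: rP; rewrite -ball_normE /= opprD opprD !addrA subrr sub0r -opprD normrN.
  apply: (le_lt_trans (ler_normD _ _)); rewrite !normrZ !gtr0_norm //.
  apply: (@le_lt_trans _ _ ((r / k) * (`|v'| + `|w'|))).
    by rewrite mulrDr lerD // ler_wpM2r // ltW.
  rewrite -mulrA gtr_pMr // mulrC ltr_pdivrMr // mul1r /k.
  by rewrite ltrDl.
have [d1 d10 P1] := near0 _ v w (smooth_derive w (smooth_derive v sf)).
have [d2 d20 P2] := near0 _ w v (smooth_derive v (smooth_derive w sf)).
pose h := Num.min d1 d2.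
have h0 : 0 < h by rewrite lt_min d10.
have hd1 : h <= d1 by rewrite ge_min lexx.
have hd2 : h <= d2 by rewrite ge_min lexx orbT.
have [s [t [/andP[s0 sh] /andP[t0 th] E]]] := second_difference x v w sf h0.
have [s' [t' [/andP[s'0 s'h] /andP[t'0 t'h] E']]] := second_difference x w v sf h0.
(* The second differences for v, w and for w, v are the same number once the two shifts are
   interchanged; cancelling h^2 leaves the two derivatives, at different nearby points. *)
have {E E'} EE : 'D_w (fun y => 'D_v f y) (x + s *: v + t *: w) =
   'D_v (fun y => 'D_w f y) (x + s' *: w + t' *: v).
  have hh : h ^+ 2 != 0 by rewrite expf_neq0 // gt_eqF.
  have alg (i j a1 a2 r1 r2 r0 : R) : a1 - r1 - (r2 - r0) = h ^+ 2 * i ->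
      a2 - r2 - (r1 - r0) = h ^+ 2 * j -> a2 = a1 -> i = j.
    by move=> e1 e3 a21; apply: (mulfI hh); rewrite -e1 -e3 a21; ring.
  by apply: (alg _ _ _ _ _ _ _ E E'); rewrite addrAC.
apply: (distr_half_le (P1 s t _ _) (P2 s' t' _ _) EE).
- by rewrite s0 /= (lt_le_trans sh hd1).
- by rewrite t0 /= (lt_le_trans th hd1).
- by rewrite s'0 /= (lt_le_trans s'h hd2).
- by rewrite t'0 /= (lt_le_trans t'h hd2).
Qed.

End Schwarz.

(** * Derivatives along vector fields *)

Section FiniteDimension.
Context {R : realType} {V : normedModType R} {I : finType}.
Variables (e : I -> V) (l : I -> {linear V -> R}).
Hypothesis l_continuous : forall i, continuous (l i).
Hypothesis coord_decomposition : forall v, v = \sum_i l i v *: e i.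
Implicit Types W U : normedModType R.

Lemma derive_coordE W (f : V -> W) x v : differentiable f x ->
  'D_v f x = \sum_i l i v *: 'D_(e i) f x.
Proof.
move=> df; rewrite deriveE // [in LHS](coord_decomposition v) linear_sum.
by apply: eq_bigr => i _; rewrite linearZ deriveE.
Qed.

(** [smooth] speaks of constant directions only. Coordinates write a derivative in a varying
    direction as a combination of derivatives in constant directions with smooth coefficients. *)
Lemma smooth_derive_field W (X : V -> V) (f : V -> W) :
  smooth X -> smooth f -> smooth (fun x => 'D_(X x) f x).
Proof.
move=> sX sf.
apply: (@eq_smooth _ _ _ _ (fun x => \sum_i l i (X x) *: 'D_(e i) f x)) => [x|].
  by apply: derive_coordE; exact: smooth_differentiable.
apply: smooth_sum => i; apply: smoothZ; first exact: smooth_linear_comp.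
exact: smooth_derive.
Qed.

Lemma smooth_bracket (X Y : V -> V) : smooth X -> smooth Y -> smooth (bracket X Y).
Proof. by move=> sX sY; apply: smoothB; apply: smooth_derive_field. Qed.

Lemma derive_derive_field (X : V -> V) (f : V -> R) x v : smooth X -> smooth f ->
  'D_v (fun y => 'D_(X y) f y) x
    = 'D_('D_v X x) f x + 'D_(X x) (fun y => 'D_v f y) x.
Proof.
move=> sX sf.
have df y : differentiable f y by exact: smooth_differentiable.
have dX y : differentiable X y by exact: smooth_differentiable.
have dl i y : differentiable (l i) y by exact: linear_differentiable.
have -> : (fun y => 'D_(X y) f y) = fun y => \sum_i l i (X y) * 'D_(e i) f y.
  by apply/funext => y; rewrite derive_coordE.
have dlX i y : differentiable (fun y => l i (X y)) y.
  exact: differentiable_comp.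
have sfi i : smooth (fun y => 'D_(e i) f y) by exact: smooth_derive.
rewrite derive_sum_fun; last first.
  by move=> i; apply: differentiableM => //; exact: smooth_differentiable.
rewrite [X in X + _]derive_coordE // [X in _ + X]derive_coordE; last first.
  exact/smooth_differentiable/smooth_derive.
rewrite -big_split; apply: eq_bigr => i _ /=.
have -> := deriveM_fun v (dlX i x) (smooth_differentiable x (sfi i)).
by rewrite (derive_linear_comp v (l_continuous (i := i)) (dX x)) (derive_comm _ _ _ sf).
Qed.

(** The bracket is defined by an ambient formula; it acts as the commutator because the two
    second-order terms cancel by symmetry. *)
Lemma derive_bracket (X Y : V -> V) (f : V -> R) x :
  smooth X -> smooth Y -> smooth f ->
  'D_(X x) (fun y => 'D_(Y y) f y) x - 'D_(Y x) (fun y => 'D_(X y) f y) x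
    = 'D_(bracket X Y x) f x.
Proof.
move=> sX sY sf; rewrite (derive_derive_field x (X x) sY sf).
rewrite (derive_derive_field x (Y x) sX sf) (derive_comm (X x) (Y x) x sf).
have df : differentiable f x by exact: smooth_differentiable.
have D u : 'D_u f x = 'd f x u by exact: deriveE.
by rewrite opprD addrACA subrr addr0 /bracket !D -linearB.
Qed.

End FiniteDimension.

(** * Curvature of submanifolds *)

Section LeviCivita.
Context {R : realType} {V : normedModType R}.
Variables (M : set V) (TM : V -> set V) (g : V -> V -> V -> R).
Variable nabla : (V -> V) -> (V -> V) -> V -> V.

Hypothesis TM_linear : forall x (a : R) v w, M x -> TM x v -> TM x w ->
  TM x (a *: v + w).
Hypothesis TM0 : forall x, M x -> TM x 0.
(** This is what allows an identity that holds only on [M], such as compatibility with the metric,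
    to be differentiated. *)
Hypothesis derive_local : forall (f f' : V -> R) x v, smooth f -> smooth f' ->
  (forall y, M y -> f y = f' y) -> M x -> TM x v -> 'D_v f x = 'D_v f' x.
Hypothesis smooth_derive_along : forall (X : V -> V) (f : V -> R),
  smooth X -> smooth f -> smooth (fun x => 'D_(X x) f x).
Hypothesis bracket_smooth : forall X Y : V -> V,
  smooth X -> smooth Y -> smooth (bracket X Y).
Hypothesis derive_along_bracket : forall (X Y : V -> V) (f : V -> R) x,
  smooth X -> smooth Y -> smooth f ->
  'D_(X x) (fun y => 'D_(Y y) f y) x - 'D_(Y x) (fun y => 'D_(X y) f y) x
    = 'D_(bracket X Y x) f x.
(** This takes the place of bump functions in proofs of tensoriality: a field vanishing at [x] is a
    combination of fields with coefficients vanishing at [x]. *)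
Hypothesis finitely_generated : forall W x, vector_field M TM W -> M x -> W x = 0 ->
  exists (J : finType) (f : J -> V -> R) (E : J -> V -> V),
    [/\ forall j, smooth (f j), forall j, vector_field M TM (E j),
        forall j, f j x = 0
      & forall y, M y -> W y = \sum_j f j y *: E j y].
Hypothesis g_metric : riemannian_metric M TM g.
Hypothesis LC : levi_civita M TM g nabla.

Local Notation vf := (vector_field M TM).

Lemma vector_field_linear (f : V -> R) X Y : smooth f -> vf X -> vf Y ->
  vf (fun y => f y *: X y + Y y).
Proof.
move=> sf [sX tX] [sY tY]; split; first by apply: smoothD => //; exact: smoothZ.
by move=> x Mx; apply: TM_linear; [|exact: tX|exact: tY].
Qed.

Lemma vector_field0 : vf (fun=> 0).
Proof. by split=> //; exact: smooth_cst. Qed.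

Lemma vector_fieldD X Y : vf X -> vf Y -> vf (fun y => X y + Y y).
Proof.
move=> vX vY; rewrite (_ : (fun y => _) = fun y => (fun=> 1) y *: X y + Y y).
  by apply: vector_field_linear => //; exact: smooth_cst.
by apply/funext => y; rewrite scale1r.
Qed.

Lemma vector_fieldZ (f : V -> R) X : smooth f -> vf X -> vf (fun y => f y *: X y).
Proof.
move=> sf vX; rewrite (_ : (fun y => _) = fun y => f y *: X y + (fun=> 0) y).
  by apply: vector_field_linear => //; exact: vector_field0.
by apply/funext => y; rewrite addr0.
Qed.

Lemma vector_fieldB X Y : vf X -> vf Y -> vf (fun y => X y - Y y).
Proof.
move=> vX vY; apply: vector_fieldD => //.
rewrite (_ : (fun y => _) = fun y => (fun=> -1) y *: Y y).
  by apply: vector_fieldZ => //; exact: smooth_cst.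
by apply/funext => y; rewrite scaleN1r.
Qed.

Lemma metricC x v w : M x -> TM x v -> TM x w -> g x v w = g x w v.
Proof. by case: g_metric => gC _ _ _ Mx tv tw; exact: gC. Qed.

Lemma metricPl x a v v' w : M x -> TM x v -> TM x v' -> TM x w ->
  g x (a *: v + v') w = a * g x v w + g x v' w.
Proof. by case: g_metric => _ gl _ _ Mx tv tv' tw; exact: gl. Qed.

Lemma metricDl x v v' w : M x -> TM x v -> TM x v' -> TM x w ->
  g x (v + v') w = g x v w + g x v' w.
Proof. by move=> *; rewrite -[v]scale1r metricPl // scale1r mul1r. Qed.

Lemma metric0l x w : M x -> TM x w -> g x 0 w = 0.
Proof.
move=> Mx tw; have := metricPl 1 Mx (TM0 Mx) (TM0 Mx) tw.
rewrite scaler0 addr0 mul1r => /eqP.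
by rewrite -subr_eq0 opprD addrA subrr sub0r oppr_eq0 => /eqP.
Qed.

Lemma metricZl x a v w : M x -> TM x v -> TM x w -> g x (a *: v) w = a * g x v w.
Proof.
by move=> Mx tv tw; rewrite -[a *: v]addr0 metricPl ?metric0l ?addr0 //; exact: TM0.
Qed.

Lemma metricBl x v v' w : M x -> TM x v -> TM x v' -> TM x w ->
  g x (v - v') w = g x v w - g x v' w.
Proof. by move=> *; rewrite addrC -scaleN1r metricPl // mulN1r addrC. Qed.

Lemma metricDr x v v' w : M x -> TM x v -> TM x v' -> TM x w ->
  g x w (v + v') = g x w v + g x w v'.
Proof.
move=> Mx tv tv' tw; rewrite ![g x w _]metricC ?metricDl //.
by rewrite -[v]scale1r; exact: TM_linear.
Qed.

Lemma metricZr x a v w : M x -> TM x v -> TM x w -> g x v (a *: w) = a * g x v w.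
Proof.
move=> Mx tv tw; rewrite metricC ?metricZl //; first by rewrite metricC.
by rewrite -[_ *: _]addr0; apply: TM_linear => //; exact: TM0.
Qed.

Lemma metric_eq0 x v : M x -> TM x v -> g x v v = 0 -> v = 0.
Proof.
case: g_metric => _ _ gp _ Mx tv gv; apply: contrapT => /eqP v0.
by have := gp x Mx v tv v0; rewrite gv ltxx.
Qed.

Lemma metric_smooth X Y : vf X -> vf Y -> smooth (fun x => g x (X x) (Y x)).
Proof. by case: g_metric => _ _ _; exact. Qed.

Lemma nabla_vf X Y : vf X -> vf Y -> vf (nabla X Y).
Proof. by case: LC => -[+ _ _ _ _] _ _; exact. Qed.

Lemma nabla_tangent X Y x : M x -> vf X -> vf Y -> TM x (nabla X Y x).
Proof. by move=> Mx vX vY; have [_] := nabla_vf vX vY; exact. Qed.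

Lemma eq_nabla X X' Y Y' x : vf X -> vf X' -> vf Y -> vf Y' ->
  (forall y, M y -> X y = X' y) -> (forall y, M y -> Y y = Y' y) -> M x ->
  nabla X Y x = nabla X' Y' x.
Proof. by case: LC => -[_ h _ _ _] _ _ *; exact: h. Qed.

Lemma nablaPl (f : V -> R) X X' Y x : smooth f -> vf X -> vf X' -> vf Y -> M x ->
  nabla (fun y => f y *: X y + X' y) Y x = f x *: nabla X Y x + nabla X' Y x.
Proof. by case: LC => -[_ _ h _ _] _ _ *; exact: h. Qed.

Lemma nablaDr X Y Y' x : vf X -> vf Y -> vf Y' -> M x ->
  nabla X (fun y => Y y + Y' y) x = nabla X Y x + nabla X Y' x.
Proof. by case: LC => -[_ _ _ h _] _ _ *; exact: h. Qed.

Lemma nabla_leibniz (f : V -> R) X Y x : smooth f -> vf X -> vf Y -> M x ->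
  nabla X (fun y => f y *: Y y) x = 'D_(X x) f x *: Y x + f x *: nabla X Y x.
Proof. by case: LC => -[_ _ _ _ h] _ _ *; exact: h. Qed.

Lemma nabla_bracket X Y x : vf X -> vf Y -> M x ->
  bracket X Y x = nabla X Y x - nabla Y X x.
Proof. by case: LC => _ h _ *; rewrite h. Qed.

Lemma nabla_metric X Y Z x : vf X -> vf Y -> vf Z -> M x ->
  'D_(X x) (fun y => g y (Y y) (Z y)) x
    = g x (nabla X Y x) (Z x) + g x (Y x) (nabla X Z x).
Proof. by case: LC => _ _ h *; exact: h. Qed.

Lemma koszul X Y Z x : vf X -> vf Y -> vf Z -> M x ->
  2 * g x (nabla X Y x) (Z x)
    = 'D_(X x) (fun y => g y (Y y) (Z y)) x + 'D_(Y x) (fun y => g y (X y) (Z y)) x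
      - 'D_(Z x) (fun y => g y (X y) (Y y)) x
      + g x (bracket X Y x) (Z x) - g x (bracket X Z x) (Y x)
      - g x (bracket Y Z x) (X x).
Proof.
move=> vX vY vZ Mx.
have [[_ tX] [_ tY] [_ tZ]] := And3 vX vY vZ.
have tn X' Y' : vf X' -> vf Y' -> TM x (nabla X' Y' x) by exact: nabla_tangent.
rewrite !nabla_bracket // !nabla_metric // !metricBl //;
  do ?[exact: tn|exact: tX|exact: tY|exact: tZ].
rewrite ![g x (X x) _]metricC ?[g x (Y x) _]metricC //;
  do ?[exact: tn|exact: tX|exact: tY|exact: tZ].
ring.
Qed.

(** Tangency of the bracket comes from vanishing torsion: on [M] the bracket is a difference of two
    covariant derivatives, which are tangent by axiom. *)
Lemma bracket_vf X Y : vf X -> vf Y -> vf (bracket X Y).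
Proof.
move=> vX vY; split; first by apply: bracket_smooth; [case: vX|case: vY].
move=> x Mx; rewrite nabla_bracket //.
have [_] := vector_fieldB (nabla_vf vX vY) (nabla_vf vY vX); exact.
Qed.

Lemma nabla0r X x : vf X -> M x -> nabla X (fun=> 0) x = 0.
Proof.
move=> vX Mx; have := nablaDr vX vector_field0 vector_field0 Mx.
rewrite (_ : (fun y : V => 0 + 0) = fun=> 0); last by apply/funext => y; rewrite addr0.
by move/eqP; rewrite -subr_eq0 opprD addrA subrr sub0r oppr_eq0 => /eqP.
Qed.

(** Linearity over functions, applied to a decomposition of [W] whose coefficients vanish at [x],
    makes every term vanish. [Phi] stands for an operator already evaluated at [x]. *)
Lemma tensorial_eq0 (Phi : (V -> V) -> V) x : M x ->
  (forall X X', vf X -> vf X' -> (forall y, M y -> X y = X' y) -> Phi X = Phi X') ->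
  (forall (f : V -> R) X X', smooth f -> vf X -> vf X' ->
    Phi (fun y => f y *: X y + X' y) = f x *: Phi X + Phi X') ->
  forall W, vf W -> W x = 0 -> Phi W = 0.
Proof.
move=> Mx Phi_eq Phi_lin W vW W0.
have Phi0 : Phi (fun=> 0) = 0.
  have s1 : smooth (fun _ : V => 1 : R) by exact: smooth_cst.
  have := Phi_lin _ _ _ s1 vector_field0 vector_field0.
  rewrite (_ : (fun y : V => 1 *: 0 + 0) = fun=> 0); last first.
    by apply/funext => y; rewrite scaler0 addr0.
  by rewrite scale1r => /eqP; rewrite -subr_eq0 opprD addrA subrr sub0r oppr_eq0 => /eqP.
have [J [f [E [sf vE f0 WE]]]] := finitely_generated vW Mx W0.
have {}WE : forall y, M y -> W y = \sum_(j <- enum J) f j y *: E j y.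
  by move=> y My; rewrite WE // big_enum.
suff H (r : seq J) : vf (fun y => \sum_(j <- r) f j y *: E j y) /\
    Phi (fun y => \sum_(j <- r) f j y *: E j y) = 0.
  by have [vS <-] := H (enum J); exact: Phi_eq.
elim: r => [|j r [vS PhiS]].
  rewrite (_ : (fun y => _) = fun=> 0); last by apply/funext => y; rewrite big_nil.
  by split; first exact: vector_field0.
rewrite (_ : (fun y => _) = fun y => f j y *: E j y + \sum_(j <- r) f j y *: E j y).
  by rewrite Phi_lin // f0 scale0r add0r; split=> //; exact: vector_field_linear.
by apply/funext => y; rewrite big_cons.
Qed.

Lemma tensorial_eq (Phi : (V -> V) -> V) x : M x ->
  (forall X X', vf X -> vf X' -> (forall y, M y -> X y = X' y) -> Phi X = Phi X') ->
  (forall (f : V -> R) X X', smooth f -> vf X -> vf X' ->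
    Phi (fun y => f y *: X y + X' y) = f x *: Phi X + Phi X') ->
  forall (a : R) X Y, vf X -> vf Y -> X x = a *: Y x -> Phi X = a *: Phi Y.
Proof.
move=> Mx Phi_eq Phi_lin a X Y vX vY XY.
have saY : smooth (fun _ : V => a) by exact: smooth_cst.
have vW : vf (fun y => X y - a *: Y y).
  by apply: vector_fieldB => //; exact: vector_fieldZ.
have PW : Phi (fun y => X y - a *: Y y) = 0.
  by apply: (tensorial_eq0 Mx) => //; rewrite XY subrr.
have := Phi_lin _ _ _ saY vY vW; rewrite PW addr0 => <-.
apply: Phi_eq => //; first exact: vector_field_linear.
by move=> y _; rewrite addrC subrK.
Qed.

Lemma nabla_tensorial (a : R) X Y Z x : M x -> vf X -> vf Y -> vf Z ->
  X x = a *: Y x -> nabla X Z x = a *: nabla Y Z x.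
Proof.
move=> Mx vX vY vZ; apply: (tensorial_eq (Phi := fun W => nabla W Z x) Mx) => //.
  by move=> W W' vW vW' WW'; apply: eq_nabla.
by move=> f W W' sf vW vW'; rewrite nablaPl.
Qed.

(** The derivative of [f] appears twice and cancels: once from the product rule in
    [nabla Y (nabla (f W) Z)], once from the bracket of f W and Y, which is f [W, Y] - (Y f) W on
    [M]. *)
Lemma curvature_tensorial (a : R) X X' Y Z x :
  M x -> vf X -> vf X' -> vf Y -> vf Z -> X x = a *: X' x ->
  curvature nabla X Y Z x = a *: curvature nabla X' Y Z x.
Proof.
move=> Mx vX vX' vY vZ.
apply: (tensorial_eq (Phi := fun W => curvature nabla W Y Z x) Mx) => //.
- move=> W W' vW vW' WW'; rewrite /curvature; congr (_ - _ - _).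
  + by apply: eq_nabla => //; exact: nabla_vf.
  + by apply: eq_nabla => //; [exact: nabla_vf|exact: nabla_vf|move=> y My; apply: eq_nabla].
  + apply: eq_nabla => //; [exact: bracket_vf|exact: bracket_vf|].
    by move=> y My; rewrite !nabla_bracket //; congr (_ - _); apply: eq_nabla.
- move=> f W W' sf vW vW'; rewrite /curvature.
  have [sY _] := vY.
  have vWZ := nabla_vf vW vZ; have vW'Z := nabla_vf vW' vZ.
  have vYZ := nabla_vf vY vZ.
  have vWY := bracket_vf vW vY; have vW'Y := bracket_vf vW' vY.
  have vfW := vector_field_linear sf vW vW'.
  have sYf : smooth (fun y => - 'D_(Y y) f y) by apply/smoothN/smooth_derive_along.
  rewrite nablaPl //.
  have -> : nabla Y (nabla (fun y => f y *: W y + W' y) Z) x =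
      'D_(Y x) f x *: nabla W Z x + f x *: nabla Y (nabla W Z) x
      + nabla Y (nabla W' Z) x.
    rewrite -nabla_leibniz // -nablaDr //; last exact: vector_fieldZ.
    apply: eq_nabla => //; [exact: nabla_vf|exact: vector_field_linear|].
    by move=> y My; rewrite nablaPl.
  have -> : nabla (bracket (fun y => f y *: W y + W' y) Y) Z x =
      f x *: nabla (bracket W Y) Z x
      + (- 'D_(Y x) f x *: nabla W Z x + nabla (bracket W' Y) Z x).
    rewrite -(nablaPl sYf) // -(nablaPl sf) //; last exact: vector_field_linear.
    apply: eq_nabla => //; [exact: bracket_vf| |].
      by apply: vector_field_linear => //; exact: vector_field_linear.
    move=> y My; rewrite !nabla_bracket // nablaPl // nablaDr //; last exact: vector_fieldZ.
    rewrite nabla_leibniz // scalerBr scaleNr !opprD !addrA.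
    rewrite -!addrA; congr (_ + _).
    by rewrite addrCA [X in _ = X]addrCA; congr (_ + _); rewrite addrCA.
  rewrite !scalerBr scaleNr !opprD opprK !addrA.
  set a1 := f x *: nabla W _ x; set a2 := nabla W' _ x; set a3 := 'D_(Y x) f x *: _.
  set a4 := f x *: _; set a5 := nabla Y _ x; set a6 := f x *: _.
  set a7 := nabla (bracket _ _) _ _.
  by rewrite [LHS](ACl (1*4*6*2*5*8*(7*3))) /= subrr addr0.
Qed.

Lemma curvature_tangent X Y Z x : M x -> vf X -> vf Y -> vf Z ->
  TM x (curvature nabla X Y Z x).
Proof.
move=> Mx vX vY vZ; have vb := bracket_vf vX vY.
have [_] := vector_fieldB (vector_fieldB (nabla_vf vX (nabla_vf vY vZ))
  (nabla_vf vY (nabla_vf vX vZ))) (nabla_vf vb vZ); exact.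
Qed.

(** The commutator of the derivatives along [X] and [Y] is applied to the function g (Z, U).
    Expanding by compatibility with the metric, the products of two first covariant derivatives
    cancel. *)
Lemma curvature_antisym X Y Z U x :
  M x -> vf X -> vf Y -> vf Z -> vf U ->
  g x (curvature nabla X Y Z x) (U x) = - g x (Z x) (curvature nabla X Y U x).
Proof.
move=> Mx vX vY vZ vU.
have [sX tX] := vX; have [sY tY] := vY; have [_ tZ] := vZ; have [_ tU] := vU.
have vb := bracket_vf vX vY.
have nt X' Y' : vf X' -> vf Y' -> TM x (nabla X' Y' x) by move=> *; exact: nabla_tangent.
have vXZ := nabla_vf vX vZ; have vYZ := nabla_vf vY vZ.
have vXU := nabla_vf vX vU; have vYU := nabla_vf vY vU.
have sZU : smooth (fun y => g y (Z y) (U y)) by exact: metric_smooth.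
have second P Q : vf P -> vf Q ->
    'D_(P x) (fun y => 'D_(Q y) (fun y => g y (Z y) (U y)) y) x
   = g x (nabla P (nabla Q Z) x) (U x) + g x (nabla Q Z x) (nabla P U x)
   + (g x (nabla P Z x) (nabla Q U x) + g x (Z x) (nabla P (nabla Q U) x)).
  move=> vP vQ; have vQZ := nabla_vf vQ vZ; have vQU := nabla_vf vQ vU.
  have s1 := metric_smooth vQZ vU; have s2 := metric_smooth vZ vQU.
  have [sQ _] := vQ; have [_ tP] := vP.
  rewrite -!nabla_metric // -deriveD_fun; try exact: smooth_differentiable.
  (* The inner derivative agrees with its metric expansion on [M] only, which suffices since [P] is
     tangent. *)
  apply: derive_local => //; [exact: smooth_derive_along|exact: smoothD| |exact: tP].
  by move=> y My; rewrite nabla_metric.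
have := derive_along_bracket x sX sY sZU.
rewrite !second // nabla_metric // /curvature.
have tB v w : TM x v -> TM x w -> TM x (v - w).
  by move=> tv tw; rewrite addrC -scaleN1r; exact: TM_linear.
have tZx := tZ x Mx; have tUx := tU x Mx.
have t1 := nt _ _ vX vYZ; have t2 := nt _ _ vY vXZ; have t3 := nt _ _ vb vZ.
have t4 := nt _ _ vX vYU; have t5 := nt _ _ vY vXU; have t6 := nt _ _ vb vU.
have expand v1 v2 v3 w : TM x v1 -> TM x v2 -> TM x v3 -> TM x w ->
    g x (v1 - v2 - v3) w = g x v1 w - g x v2 w - g x v3 w.
  by move=> *; rewrite !metricBl //; exact: tB.
rewrite [g x (Z x) (_ - _)]metricC //; last exact: (tB _ _ (tB _ _ t4 t5) t6).
rewrite !expand // ![g x _ (Z x)]metricC //.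
by move=> E; move: E; lra.
Qed.

(** * Geodesic fields *)

Section GeodesicField.
Variable T : V -> V.
Hypothesis T_vf : vf T.
Hypothesis T_geodesic : forall x, M x -> nabla T T x = 0.

(* The last three terms are [- 1/2 (L_T L_T g)(Y, Y)]. *)
Lemma mixed_curvature Y x : M x -> vf Y ->
  g x (curvature nabla T Y Y x) (T x)
    = g x (nabla Y T x) (nabla Y T x) + g x (nabla Y T x) (bracket T Y x)
      + g x (nabla (bracket T Y) T x) (Y x)
      - 'D_(T x) (fun y => g y (nabla Y T y) (Y y)) x.
Proof.
move=> Mx vY; have [_ tY] := vY; have [_ tT] := T_vf.
have vYT := nabla_vf vY T_vf; have vTY := nabla_vf T_vf vY.
have vb := bracket_vf T_vf vY.
have [t1 t2 t3 t4] : [/\ TM x (nabla Y T x), TM x (bracket T Y x),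
   TM x (nabla (bracket T Y) T x) & TM x (nabla T (nabla Y T) x)].
  split; [exact: nabla_tangent| |exact: nabla_tangent|exact: nabla_tangent].
  by case: vb => _; exact.
(* Moving the curvature operator onto [T] makes [nabla T T] appear, which vanishes. Of second order
   only [nabla T (nabla Y T)] remains, and the metric trades it for a derivative of a function. *)
rewrite curvature_antisym // metricC //; [|exact: tY|exact: curvature_tangent].
rewrite nabla_metric // /curvature.
have -> : nabla Y (nabla T T) x = 0.
  rewrite -(nabla0r vY Mx); apply: eq_nabla => //; [exact: nabla_vf|exact: vector_field0].
have tYx := tY x Mx.
rewrite subr0 metricBl // [nabla T Y x](_ : _ = nabla Y T x + bracket T Y x); last first.
  by rewrite nabla_bracket // addrC subrK.
by rewrite metricDr //; ring.
Qed.

(** [X] is a multiple of [T] at the single point [x]; tensoriality replaces it there, and the factor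
    a^2 enters numerator and denominator alike. *)
Lemma mixed_sectional_curvature X Y (a : R) x : M x -> vf X -> vf Y ->
  X x = a *: T x -> a != 0 -> g x (T x) (Y x) = 0 -> T x != 0 -> Y x != 0 ->
  0 < g x (curvature nabla T Y Y x) (T x) ->
  0 < sectional_curvature g nabla X Y x.
Proof.
move=> Mx vX vY XT a0 TY T0 Y0 K0.
have [_ tY] := vY; have [_ tT] := T_vf.
have tTx := tT x Mx; have tYx := tY x Mx.
have tC := curvature_tangent Mx T_vf vY vY.
have gp v : TM x v -> v != 0 -> 0 < g x v v.
  by case: g_metric => _ _ gp _ *; exact: gp.
have ta v : TM x v -> TM x (a *: v).
  by move=> tv; rewrite -[_ *: _]addr0; apply: TM_linear => //; exact: TM0.
have a2 : 0 < a * a by rewrite -expr2 exprn_even_gt0.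
rewrite /sectional_curvature (curvature_tensorial Mx vX T_vf vY vY XT) XT.
rewrite !metricZl ?metricZr //; try exact: ta.
rewrite TY mulr0 expr0n subr0 divr_gt0 //.
  by rewrite mulrA mulr_gt0.
by rewrite mulr_gt0 ?gp // mulrA mulr_gt0 ?gp.
Qed.

(** Along [L] the field [Y] equals [b T] with b = g (T, Y). The difference vanishes on [L] but not
    on [M]; nevertheless its covariant derivative along [T] vanishes on [L], and that of [b T] is a
    multiple of [T] because [T] is geodesic. *)
Lemma totally_geodesic_integral_manifold (L : set V) :
  L `<=` M -> (forall x, M x -> g x (T x) (T x) = 1) ->
  (forall (f : V -> R) x, smooth f -> (forall y, L y -> f y = 0) -> L x ->
     'D_(T x) f x = 0) ->
  totally_geodesic_submanifold M TM nabla L (leaf_tangent T).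
Proof.
move=> LM T1 L_der X Y vX vY LX LY x Lx.
have Mx := LM x Lx; have [a XT] := LX x Lx.
have [_ tY] := vY; have [_ tT] := T_vf.
rewrite (nabla_tensorial Mx vX T_vf vY XT).
pose b y := g y (T y) (Y y).
have sb : smooth b by exact: metric_smooth.
have vbT : vf (fun y => b y *: T y) by exact: vector_fieldZ.
have vY' : vf (fun y => Y y - b y *: T y) by exact: vector_fieldB.
set Y' := (fun y => Y y - b y *: T y) in vY'.
have Y'0 y : L y -> Y' y = 0.
  move=> Ly; have My := LM y Ly; have [c Yc] := LY y Ly.
  by rewrite /Y' /b Yc metricZr ?T1 ?mulr1 ?subrr //; exact: tT.
have TY'0 : nabla T Y' x = 0.
  have vTY' := nabla_vf T_vf vY'.
  have tTY' : TM x (nabla T Y' x) by exact: nabla_tangent.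
  (* On [L], the squared norm of [nabla T Y'] is the derivative along [T] of g (Y', nabla T Y'), a
     function that vanishes on [L]. *)
  apply: (metric_eq0 Mx) => //.
  have := nabla_metric T_vf vY' vTY' Mx.
  rewrite L_der //; last first.
  - move=> y Ly; have My := LM y Ly; rewrite Y'0 // metric0l //; exact: nabla_tangent.
  - exact: metric_smooth.
  rewrite Y'0 // metric0l // ?addr0; last by apply: nabla_tangent.
  by move=> <-.
exists (a * 'D_(T x) b x).
have -> : nabla T Y x = nabla T (fun y => b y *: T y) x + nabla T Y' x.
  rewrite -nablaDr //; apply: eq_nabla => //; first exact: vector_fieldD.
  by move=> y My; rewrite /Y' addrC subrK.
by rewrite TY'0 nabla_leibniz // T_geodesic // scaler0 !addr0 scalerA.
Qed.

End GeodesicField.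

End LeviCivita.

(** * Smooth maps into products and matrices *)

Section SmoothLinear.
Context {R : realType}.
Implicit Types U V W : normedModType R.

Lemma smooth_linear_fun U V W (L : V -> W) (f : U -> V) : linear L ->
  continuous L -> smooth f -> smooth (fun x => L (f x)).
Proof.
move=> lL cL sf.
pose LM := GRing.isLinear.Build _ _ _ _ L lL.
pose L' : {linear V -> W} := HB.pack L LM.
exact: (smooth_linear_comp (L := L')).
Qed.

Lemma smooth_fst U V W (f : U -> V * W) : smooth f -> smooth (fun x => (f x).1).
Proof. by apply: smooth_linear_fun => // x; exact: cvg_fst. Qed.

Lemma smooth_snd U V W (f : U -> V * W) : smooth f -> smooth (fun x => (f x).2).
Proof. by apply: smooth_linear_fun => // x; exact: cvg_snd. Qed.

Lemma smooth_pair U V W (f : U -> V) (h : U -> W) :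
  smooth f -> smooth h -> smooth (fun x => (f x, h x)).
Proof.
move=> sf sh.
apply: (@eq_smooth _ _ _ _ (fun x => (f x, 0) + (0, h x))) => [x|].
  by congr (_, _); rewrite ?addr0 ?add0r.
apply: smoothD.
- apply: (@smooth_linear_fun _ _ _ (fun v => (v, 0) : V * W)) => //.
    by move=> a v w; congr (_, _); rewrite /= scaler0 addr0.
  by move=> v; apply: cvg_pair => //; exact: cvg_cst.
- apply: (@smooth_linear_fun _ _ _ (fun v => (0, v) : V * W)) => //.
    by move=> a v w; congr (_, _); rewrite /= scaler0 addr0.
  by move=> v; apply: cvg_pair => //; exact: cvg_cst.
Qed.

Lemma smooth_entry U p q (F : U -> 'M[R]_(p, q)) r s :
  smooth F -> smooth (fun x => F x r s).
Proof.
apply: (@smooth_linear_fun _ _ R (fun N : 'M[R]_(p, q) => N r s)).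
  by move=> a v w; rewrite !mxE.
exact: coord_continuous.
Qed.

Lemma smooth_mx U p q (F : U -> 'M[R]_(p, q)) :
  (forall r s, smooth (fun x => F x r s)) -> smooth F.
Proof.
move=> sF; apply: (@eq_smooth _ _ _ _
  (fun x => \sum_i \sum_j F x i j *: delta_mx i j)) => [x|].
  exact: matrix_sum_delta.
do 2 apply: smooth_sum => ?; apply: smoothZ; [exact: sF|exact: smooth_cst].
Qed.

End SmoothLinear.

(** * Quaternionic linear algebra *)

Section Dot.
Context {R : realType} {m : nat}.
Implicit Types (x y v w : 'M[R]_(m, 4)) (a b : 'rV[R]_4) (c : R).

Lemma dotC x y : dot x y = dot y x.
Proof. by apply: eq_bigr => r _; apply: eq_bigr => s _; rewrite mulrC. Qed.

Lemma dotDr x y v : dot x (y + v) = dot x y + dot x v.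
Proof. by rewrite !dotE -big_split; apply: eq_bigr => r _; rewrite !mxE /=; ring. Qed.

Lemma dotZr c x y : dot x (c *: y) = c * dot x y.
Proof. by rewrite !dotE mulr_sumr; apply: eq_bigr => r _; rewrite !mxE /=; ring. Qed.

Lemma dotDl x y v : dot (y + v) x = dot y x + dot v x.
Proof. by rewrite dotC dotDr !(dotC x). Qed.

Lemma dotZl c x y : dot (c *: y) x = c * dot y x.
Proof. by rewrite dotC dotZr !(dotC x). Qed.

Lemma dotBr x y v : dot x (y - v) = dot x y - dot x v.
Proof. by rewrite -scaleN1r dotDr dotZr mulN1r. Qed.

Lemma dotBl x y v : dot (y - v) x = dot y x - dot v x.
Proof. by rewrite dotC dotBr !(dotC x). Qed.

Lemma dotNr x y : dot x (- y) = - dot x y.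
Proof. by rewrite -scaleN1r dotZr mulN1r. Qed.

Lemma dotNl x y : dot (- y) x = - dot y x.
Proof. by rewrite dotC dotNr dotC. Qed.

Lemma dot0r x : dot x 0 = 0.
Proof. by rewrite -(scale0r 0) dotZr mul0r. Qed.

Lemma dot_ge0 x : 0 <= dot x x.
Proof. by apply: sumr_ge0 => r _; apply: sumr_ge0 => s _; rewrite -expr2 sqr_ge0. Qed.

Lemma dot_eq0 x : dot x x = 0 -> x = 0.
Proof.
move=> /eqP; rewrite psumr_eq0; last first.
  by move=> r _; apply: sumr_ge0 => s _; rewrite -expr2 sqr_ge0.
move=> /allP h; apply/matrixP => r s; rewrite mxE.
have := h r (mem_index_enum r); rewrite psumr_eq0; last first.
  by move=> k _; rewrite -expr2 sqr_ge0.
by move=> /allP/(_ s (mem_index_enum s)); rewrite mulf_eq0 orbb => /eqP.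
Qed.

Lemma qmulDl x y a : qmul (x + y) a = qmul x a + qmul y a.
Proof. by rewrite -[x in LHS]scale1r qmul_linear scale1r. Qed.

Lemma smooth_dot (U : normedModType R) (F G : U -> 'M[R]_(m, 4)) :
  smooth F -> smooth G -> smooth (fun z => dot (F z) (G z)).
Proof.
move=> sF sG; do 2 apply: smooth_sum => ?; apply: smoothM; exact: smooth_entry.
Qed.

Lemma derive_dot (U : normedModType R) (F G : U -> 'M[R]_(m, 4)) (x v : U) :
  smooth F -> smooth G ->
  'D_v (fun z => dot (F z) (G z)) x = dot ('D_v F x) (G x) + dot (F x) ('D_v G x).
Proof.
move=> sF sG.
have dM r s : smooth (fun z => F z r s * G z r s).
  by apply: smoothM; exact: smooth_entry.
rewrite /dot derive_sum_fun; last first.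
  by move=> r; apply: smooth_differentiable; exact: smooth_sum.
rewrite -big_split; apply: eq_bigr => r _ /=.
rewrite derive_sum_fun; last by move=> s; exact: smooth_differentiable.
rewrite -big_split; apply: eq_bigr => s _ /=.
have dF : differentiable (fun z => F z r s) x.
  exact/smooth_differentiable/smooth_entry.
have dG : differentiable (fun z => G z r s) x.
  exact/smooth_differentiable/smooth_entry.
have -> := deriveM_fun v dF dG.
by rewrite (derive_mx (smooth_derivable sF)) (derive_mx (smooth_derivable sG)) !mxE.
Qed.

Lemma smooth_qmul (U : normedModType R) (F : U -> 'M[R]_(m, 4)) a :
  smooth F -> smooth (fun z => qmul (F z) a).
Proof.
move=> sF; apply: smooth_mx => r.
have k s c : smooth (fun z => F z r s * c).
  by apply: smoothM; [exact: smooth_entry|exact: smooth_cst].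
by apply: forall_I4; (apply: eq_smooth => [x|]; [rewrite mxE /=; reflexivity|]);
  do ?[exact: k|apply: smoothB|apply: smoothD].
Qed.

Lemma qmul_continuous a : continuous (fun x => qmul x a).
Proof.
move=> x; apply: differentiable_continuous; apply: smooth_differentiable.
exact/smooth_qmul/smooth_id.
Qed.

Lemma derive_qmul (U : normedModType R) (F : U -> 'M[R]_(m, 4)) a (x v : U) :
  differentiable F x -> 'D_v (fun z => qmul (F z) a) x = qmul ('D_v F x) a.
Proof.
move=> dF.
have lq : linear (fun x => qmul x a) by move=> c y z; rewrite qmul_linear.
pose LM := GRing.isLinear.Build _ _ _ _ (fun x => qmul x a) lq.
pose L : {linear 'M[R]_(m, 4) -> 'M[R]_(m, 4)} := HB.pack (fun x => qmul x a) LM.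
by apply: (derive_linear_comp (L := L)); first exact: qmul_continuous.
Qed.

End Dot.

(** * The product of spheres *)

Section Coordinates.
Context {R : realType} {m : nat}.
Local Notation V := ('M[R]_(m, 4) * 'rV[R]_4)%type.
Local Notation I := ('I_m * 'I_4 + 'I_4)%type.

Definition coordf (i : I) (z : V) : R :=
  match i with inl rs => z.1 rs.1 rs.2 | inr s => z.2 0 s end.

Definition coord_vec (i : I) : V :=
  match i with inl rs => (delta_mx rs.1 rs.2, 0) | inr s => (0, delta_mx 0 s) end.

Fact coordf_linear i : linear (coordf i).
Proof. by case: i => [[r s]|s] a v w; rewrite /= !mxE. Qed.

HB.instance Definition _ i :=
  GRing.isLinear.Build R V R *:%R (coordf i) (coordf_linear i).

Lemma coordf_continuous i : continuous (coordf i).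
Proof.
move=> z; apply: differentiable_continuous; apply: smooth_differentiable.
case: i => [[r s]|s] /=; apply: smooth_entry.
  exact/smooth_fst/smooth_id.
exact/smooth_snd/smooth_id.
Qed.

Lemma sum_coordf (z : V) : z = \sum_i coordf i z *: coord_vec i.
Proof.
rewrite big_sumType /=.
have -> : \sum_(rs : 'I_m * 'I_4) z.1 rs.1 rs.2 *: ((delta_mx rs.1 rs.2, 0) : V)
    = (z.1, 0).
  have fstE (F : 'I_m * 'I_4 -> V) : (\sum_i F i).1 = \sum_i (F i).1.
    exact: (raddf_sum (fst : {additive V -> 'M[R]_(m, 4)})).
  have sndE (F : 'I_m * 'I_4 -> V) : (\sum_i F i).2 = \sum_i (F i).2.
    exact: (raddf_sum (snd : {additive V -> 'rV[R]_4})).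
  rewrite [LHS]surjective_pairing fstE sndE /=; congr (_, _).
    by rewrite [in RHS](matrix_sum_delta z.1) pair_bigA.
  by rewrite big1 // => i _; rewrite scaler0.
have -> : \sum_(s : 'I_4) z.2 0 s *: ((0, delta_mx 0 s) : V) = (0, z.2).
  have fstE (F : 'I_4 -> V) : (\sum_i F i).1 = \sum_i (F i).1.
    exact: (raddf_sum (fst : {additive V -> 'M[R]_(m, 4)})).
  have sndE (F : 'I_4 -> V) : (\sum_i F i).2 = \sum_i (F i).2.
    exact: (raddf_sum (snd : {additive V -> 'rV[R]_4})).
  rewrite [LHS]surjective_pairing fstE sndE /=; congr (_, _).
    by rewrite big1 // => i _; rewrite scaler0.
  by rewrite [in RHS](row_sum_delta z.2).
by rewrite [LHS]surjective_pairing; congr (_, _); rewrite ?addr0 ?add0r.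
Qed.

End Coordinates.

Section ProductOfSpheres.
Context {R : realType} {m : nat}.
Local Notation V := ('M[R]_(m, 4) * 'rV[R]_4)%type.
Local Notation M := (@prodM R m).
Local Notation TM := (@prodTM R m).

Lemma prodTM_linear (x : V) (a : R) v w :
  TM x v -> TM x w -> TM x (a *: v + w).
Proof.
by move=> [v1 v2] [w1 w2]; split; rewrite /sphere_tangent /= dotDr dotZr
  ?v1 ?w1 ?v2 ?w2 mulr0 addr0.
Qed.

Lemma prodTM0 (x : V) : TM x 0.
Proof. by split; rewrite /sphere_tangent /= dot0r. Qed.

(* The inverse stereographic projection of a tangent line. *)
Definition sphere_curve n (x v : 'M[R]_(n, 4)) (t : R) : 'M[R]_(n, 4) :=
  let k := dot v v / 4 in
  (1 - k * t ^+ 2) / (1 + k * t ^+ 2) *: x + t / (1 + k * t ^+ 2) *: v.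

Lemma sphere_curve0 n (x v : 'M[R]_(n, 4)) : sphere_curve x v 0 = x.
Proof.
by rewrite /sphere_curve expr0n mulr0 subr0 addr0 divr1 mul0r scale0r addr0 scale1r.
Qed.

Lemma sphere_curve_sphere n (x v : 'M[R]_(n, 4)) t : sphere x ->
  sphere_tangent x v -> sphere (sphere_curve x v t).
Proof.
rewrite /sphere /sphere_tangent /sphere_curve /= => xx xv.
have k0 : 0 <= dot v v / 4 by rewrite divr_ge0 // dot_ge0.
have : 1 + dot v v / 4 * t ^+ 2 != 0.
  by rewrite gt_eqF // ltr_wpDr // mulr_ge0 // sqr_ge0.
rewrite !dotDr !dotDl !dotZr !dotZl xx xv (dotC v) xv.
have -> : dot v v = 4 * (dot v v / 4) by rewrite mulrC divfK.
rewrite [4 * _ / 4]mulrC mulKf //; move: (dot v v / 4) => k den0; field; exact: den0.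
Qed.

Lemma sphere_curve_derive n (x v : 'M[R]_(n, 4)) :
  differentiable (sphere_curve x v) 0 /\ 'D_1 (sphere_curve x v) 0 = v.
Proof.
set k := dot v v / 4.
have den : (1 + k * (0 : R) ^+ 2) != 0 by rewrite expr0n mulr0 addr0 oner_neq0.
have d1 : is_derive (0 : R) 1 (fun t : R => (1 - k * t ^+ 2) / (1 + k * t ^+ 2)) 0.
  by apply: is_derive_eq; rewrite !(scale0r, scaler0, addr0, oppr0, mulr0).
have d2 : is_derive (0 : R) 1 (fun t : R => t / (1 + k * t ^+ 2)) 1.
  apply: is_derive_eq.
  by rewrite !(scale0r, scaler0, addr0, oppr0, mulr0, expr0n, invr1, scale1r, add0r).
have D1 : differentiable (fun t : R => (1 - k * t ^+ 2) / (1 + k * t ^+ 2)) 0.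
  by apply/derivable1_diffP.
have D2 : differentiable (fun t : R => t / (1 + k * t ^+ 2)) 0.
  by apply/derivable1_diffP.
have Z1 := differentiableZl x D1; have Z2 := differentiableZl v D2.
split; first exact: differentiableD.
rewrite [LHS](deriveD_fun _ Z1 Z2).
rewrite (deriveZ_fun _ D1 (differentiable_cst x _)).
rewrite (deriveZ_fun _ D2 (differentiable_cst v _)).
by rewrite !derive_val !scaler0 scale0r scale1r !addr0 add0r.
Qed.

(** The pair of sphere curves stays in [M] and has velocity [v] at 0, so both derivatives are taken
    along a curve on which the functions agree. The curves are rational, so no normalization of [v]
    and no case v = 0 intervene. *)
Lemma prod_derive_local (f f' : V -> R) x v : smooth f -> smooth f' ->
  (forall y, M y -> f y = f' y) -> M x -> TM x v -> 'D_v f x = 'D_v f' x.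
Proof.
move=> sf sf' ff' [x1 x2] [v1 v2].
pose c t : V := (sphere_curve x.1 v.1 t, sphere_curve x.2 v.2 t).
have [dc1 Dc1] := sphere_curve_derive x.1 v.1.
have [dc2 Dc2] := sphere_curve_derive x.2 v.2.
have dc : differentiable c 0 by exact: differentiable_pair.
have c0 : c 0 = x by rewrite /c !sphere_curve0 -surjective_pairing.
have Dc : 'd c 0 1 = v.
  rewrite diff_pair //= -!deriveE // Dc1 Dc2 -surjective_pairing //.
have chain h : smooth h -> 'D_v h x = 'D_1 (h \o c) 0.
  move=> sh; have dh y : differentiable h y by exact: smooth_differentiable.
  rewrite [RHS]deriveE; last exact: differentiable_comp.
  by rewrite diff_comp //= c0 Dc deriveE.
rewrite !chain // (_ : f \o c = f' \o c) //; apply/funext => t /=.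
by apply: ff'; split; exact: sphere_curve_sphere.
Qed.

Definition tangent_proj (x v : V) : V :=
  (v.1 - dot x.1 v.1 *: x.1, v.2 - dot x.2 v.2 *: x.2).

Lemma tangent_proj_vf v : vector_field M TM (tangent_proj^~ v).
Proof.
split.
  have s1 : smooth (fun x : V => x.1) by exact/smooth_fst/smooth_id.
  have s2 : smooth (fun x : V => x.2) by exact/smooth_snd/smooth_id.
  apply: smooth_pair; apply: smoothB; try exact: smooth_cst.
    by apply: smoothZ => //; apply: smooth_dot => //; exact: smooth_cst.
  by apply: smoothZ => //; apply: smooth_dot => //; exact: smooth_cst.
move=> x [x1 x2]; split; rewrite /sphere_tangent /= dotBr dotZr.
  by rewrite x1 mulr1 subrr.
by rewrite x2 mulr1 subrr.
Qed.

Lemma tangent_proj_id x v : TM x v -> tangent_proj x v = v.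
Proof.
by move=> [v1 v2]; rewrite /tangent_proj v1 v2 !scale0r !subr0 -surjective_pairing.
Qed.

Fact tangent_proj_linear x : linear (tangent_proj x).
Proof.
move=> a v w; rewrite /tangent_proj /=; congr (_, _).
- rewrite /= dotDr dotZr scalerDl -scalerA scalerBr opprD !addrA; congr (_ - _).
  by rewrite addrAC.
- rewrite /= dotDr dotZr scalerDl -scalerA scalerBr opprD !addrA; congr (_ - _).
  by rewrite addrAC.
Qed.

HB.instance Definition _ x :=
  GRing.isLinear.Build R V V *:%R (tangent_proj x) (tangent_proj_linear x).

(** On [M] a tangent field is its own tangential projection. It is thus the combination of the
    projected coordinate vectors whose coefficients are the coordinates of [W], and these vanish
    where [W] does. *)
Lemma prod_finitely_generated W x : vector_field M TM W -> M x -> W x = 0 ->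
  exists (J : finType) (f : J -> V -> R) (E : J -> V -> V),
    [/\ forall j, smooth (f j), forall j, vector_field M TM (E j),
        forall j, f j x = 0
      & forall y, M y -> W y = \sum_j f j y *: E j y].
Proof.
move=> [sW tW] Mx W0.
exists ('I_m * 'I_4 + 'I_4)%type, (fun j y => coordf j (W y)).
exists (fun j y => tangent_proj y (coord_vec j)); split.
- by case=> [[r s]|s]; apply: smooth_entry; [exact: smooth_fst|exact: smooth_snd].
- by move=> j; exact: tangent_proj_vf.
- by move=> j; rewrite W0 linear0.
- move=> y My; rewrite -[LHS](tangent_proj_id (tW y My)).
  rewrite [X in tangent_proj y X](sum_coordf (W y)) linear_sum.
  by apply: eq_bigr => j _; rewrite linearZ.
Qed.

End ProductOfSpheres.

(** * Right multiplication by imaginary units *)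

Section QuaternionIdentities.
Context {R : realType} {m : nat}.
Implicit Types x y : 'M[R]_(m, 4).

Lemma qmul_ij x : qmul (qmul x qi) qj = qmul x qk.
Proof. by apply/matrixP => r; apply: forall_I4; rewrite !mxE /=; ring. Qed.

Lemma qmul_ik x : qmul (qmul x qi) qk = - qmul x qj.
Proof. by apply/matrixP => r; apply: forall_I4; rewrite !mxE /=; ring. Qed.

Lemma qmul_ii x : qmul (qmul x qi) qi = - x.
Proof. by apply/matrixP => r; apply: forall_I4; rewrite !mxE /=; ring. Qed.

(** The hypothesis says that [a] is imaginary; right multiplication by such a quaternion is
    skew-symmetric. *)
Lemma eta_antisym (a : 'rV[R]_4) x y : a 0 0 = 0 -> eta a y x = - eta a x y.
Proof.
move=> a0; rewrite /eta /xi !dotE -sumrN; apply: eq_bigr => r _.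
by rewrite !mxE /= a0; ring.
Qed.

Lemma qi0 : (qi 0 0 : R) = 0. Proof. by rewrite mxE. Qed.
Lemma qj0 : (qj 0 0 : R) = 0. Proof. by rewrite mxE. Qed.
Lemma qk0 : (qk 0 0 : R) = 0. Proof. by rewrite mxE. Qed.

Lemma eta_i_qi x y : eta qi x (qmul y qi) = dot x y.
Proof.
by rewrite /eta /xi !dotE; apply: eq_bigr => r _; rewrite !mxE /=; ring.
Qed.

Lemma eta_j_qi x y : eta qj x (qmul y qi) = eta qk x y.
Proof.
by rewrite /eta /xi !dotE; apply: eq_bigr => r _; rewrite !mxE /=; ring.
Qed.

Lemma eta_k_qi x y : eta qk x (qmul y qi) = - eta qj x y.
Proof.
by rewrite /eta /xi !dotE -sumrN; apply: eq_bigr => r _; rewrite !mxE /=; ring.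
Qed.

Lemma eta_qi_i x y : eta qi (qmul x qi) y = - dot x y.
Proof. by rewrite /eta /xi qmul_ii -scaleN1r dotZl mulN1r. Qed.

Lemma eta_qi_j x y : eta qj (qmul x qi) y = eta qk x y.
Proof. by rewrite /eta /xi qmul_ij. Qed.

Lemma eta_qi_k x y : eta qk (qmul x qi) y = - eta qj x y.
Proof. by rewrite /eta /xi qmul_ik -scaleN1r dotZl mulN1r. Qed.

Lemma eta_self (a : 'rV[R]_4) x : a 0 0 = 0 -> eta a x x = 0.
Proof. by move=> a0; have := eta_antisym x x a0; lra. Qed.

Lemma etaDr a x y y' : eta a x (y + y') = eta a x y + eta a x y' :> R.
Proof. exact: dotDr. Qed.

Lemma etaZr a c x y : eta a x (c *: y) = c * eta a x y :> R.
Proof. exact: dotZr. Qed.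

Lemma etaZl a c x y : eta a (c *: x) y = c * eta a x y :> R.
Proof. by rewrite /eta /xi qmulZl dotZl. Qed.

Lemma eta_qmul (a b : 'rV[R]_4) x : eta a x (qmul x b) = dot x x * dot a b.
Proof. exact: dot_qmul. Qed.

Lemma smooth_eta (U : normedModType R) a (F G : U -> 'M[R]_(m, 4)) :
  smooth F -> smooth G -> smooth (fun z => eta a (F z) (G z)).
Proof. by move=> sF sG; apply: smooth_dot => //; exact: smooth_qmul. Qed.

Lemma derive_eta (U : normedModType R) a (F G : U -> 'M[R]_(m, 4)) (z v : U) :
  smooth F -> smooth G ->
  'D_v (fun z => eta a (F z) (G z)) z = eta a ('D_v F z) (G z) + eta a (F z) ('D_v G z).
Proof.
move=> sF sG; rewrite /eta /xi.
rewrite (derive_dot z v (smooth_qmul a sF) sG) derive_qmul //.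
exact: smooth_differentiable.
Qed.

(* The right multiplication by [i] of the component of [y] orthogonal to the
   quaternionic line of [x]. *)
Definition hor_i x y :=
  qmul y qi + (eta qi x y *: x + (eta qj x y *: qmul x qk - eta qk x y *: qmul x qj)).

(** Right multiplication by [qi] is an isometry preserving the quaternionic line of [x], hence also
    its orthogonal complement. The last identity holds because [qmul y qi] and [hor_i x y] differ by
    an element of that line. *)
Lemma hor_i_gram x y : dot x x = 1 -> dot x y = 0 ->
  [/\ dot x (hor_i x y) = 0,
      eta qi x (hor_i x y) = 0, eta qj x (hor_i x y) = 0, eta qk x (hor_i x y) = 0 &
      dot (hor_i x y) (hor_i x y)
        = dot y y - eta qi x y ^+ 2 - eta qj x y ^+ 2 - eta qk x y ^+ 2] /\
  dot (qmul y qi) (hor_i x y)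
    = dot y y - eta qi x y ^+ 2 - eta qj x y ^+ 2 - eta qk x y ^+ 2.
Proof.
move=> xx xy; have [[ii jj kk ij ik] jk] := @dot_units R.
have e (a : 'rV[R]_4) : a 0 0 = 0 -> dot x (qmul x a) = 0.
  by move=> a0; rewrite dotC; exact: eta_self.
have e' : dot x (qmul y qi) = - eta qi x y.
  by rewrite dotC -[LHS]/(eta qi y x) eta_antisym // qi0.
have h0 : dot x (hor_i x y) = 0.
  by rewrite /hor_i !dotDr dotNr !dotZr e' xx !e ?qk0 ?qj0 // !mulr0 mulr1 subrr addr0 addNr.
have hi : eta qi x (hor_i x y) = 0.
  rewrite /hor_i /eta /xi !dotDr dotNr !dotZr !dot_qmul xx ij ik.
  by rewrite [dot _ x]dotC e ?qi0 // -/(eta qi x (qmul y qi)) eta_i_qi xy; ring.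
have hj : eta qj x (hor_i x y) = 0.
  rewrite /hor_i /eta /xi !dotDr dotNr !dotZr !dot_qmul xx jj jk.
  by rewrite [dot _ x]dotC e ?qj0 // -/(eta qj x (qmul y qi)) eta_j_qi /eta /xi; ring.
have hk : eta qk x (hor_i x y) = 0.
  rewrite /hor_i /eta /xi !dotDr dotNr !dotZr !dot_qmul xx kk (dotC qk) jk.
  by rewrite [dot _ x]dotC e ?qk0 // -/(eta qk x (qmul y qi)) eta_k_qi /eta /xi; ring.
have hy : dot (qmul y qi) (hor_i x y)
    = dot y y - eta qi x y ^+ 2 - eta qj x y ^+ 2 - eta qk x y ^+ 2.
  rewrite /hor_i !dotDr dotNr !dotZr dot_qmul ii [dot _ x]dotC e'.
  rewrite ![dot (qmul y qi) _]dotC -[dot (qmul x qk) _]/(eta qk x (qmul y qi)).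
  by rewrite -[dot (qmul x qj) _]/(eta qj x (qmul y qi)) eta_k_qi eta_j_qi; ring.
do !split=> //.
rewrite {1}/hor_i !dotDl dotNl !dotZl hy h0.
by rewrite -[dot (qmul x qk) _]/(eta qk x _) hk -[dot (qmul x qj) _]/(eta qj x _) hj; ring.
Qed.

End QuaternionIdentities.

(** * The metric and its Levi-Civita connection *)

Section MetricForm.
Context {R : realType} {m : nat}.
Local Notation V := ('M[R]_(m, 4) * 'rV[R]_4)%type.
Implicit Types (z v w y : V).

(* The metric of the theorem and, in [dmform], its derivative in the direction
   [u] of the base point. *)
Definition mform (a b d e f : R) z v w : R :=
  a * dot v.1 w.1 + b * (eta qj z.1 v.1 * eta qj z.1 w.1) + d * dot v.2 w.2
  + e * (eta qi z.1 v.1 * eta qi z.2 w.2 + eta qi z.2 v.2 * eta qi z.1 w.1)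
  + f * (eta qk z.1 v.1 * eta qi z.2 w.2 + eta qi z.2 v.2 * eta qk z.1 w.1).

Definition dmform (b e f : R) z u v w : R :=
  b * (eta qj u.1 v.1 * eta qj z.1 w.1 + eta qj z.1 v.1 * eta qj u.1 w.1)
  + e * (eta qi u.1 v.1 * eta qi z.2 w.2 + eta qi z.1 v.1 * eta qi u.2 w.2
         + (eta qi u.2 v.2 * eta qi z.1 w.1 + eta qi z.2 v.2 * eta qi u.1 w.1))
  + f * (eta qk u.1 v.1 * eta qi z.2 w.2 + eta qk z.1 v.1 * eta qi u.2 w.2
         + (eta qi u.2 v.2 * eta qk z.1 w.1 + eta qi z.2 v.2 * eta qk u.1 w.1)).

Variables (a b d e f : R).
Local Notation G := (mform a b d e f).

Lemma mformC z v w : G z v w = G z w v.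
Proof. by rewrite /mform (dotC v.1) (dotC v.2); ring. Qed.

Lemma mformPl z t v v' w : G z (t *: v + v') w = t * G z v w + G z v' w.
Proof. by rewrite /mform /= !dotDl !dotZl !etaDr !etaZr; ring. Qed.

Lemma mformBl z v v' w : G z (v - v') w = G z v w - G z v' w.
Proof. by rewrite addrC -scaleN1r mformPl mulN1r addrC. Qed.

Lemma mform_smooth (U : normedModType R) (Z X Y : U -> V) :
  smooth Z -> smooth X -> smooth Y -> smooth (fun x => G (Z x) (X x) (Y x)).
Proof.
move=> sZ sX sY.
have [Z1 Z2] := (smooth_fst sZ, smooth_snd sZ).
have [X1 X2] := (smooth_fst sX, smooth_snd sX).
have [Y1 Y2] := (smooth_fst sY, smooth_snd sY).
have cst t : smooth (fun _ : U => t : R) by exact: smooth_cst.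
by do ?[exact: cst|apply: smoothD|apply: smoothM|apply: smooth_eta|apply: smooth_dot].
Qed.

End MetricForm.

Section DeriveForms.
Context {R : realType} {m : nat}.
Local Notation V := ('M[R]_(m, 4) * 'rV[R]_4)%type.
Variables (F : V -> V) (z u : V).
Hypothesis F_smooth : smooth F.

Lemma derive_fst : 'D_u (fun y => (F y).1) z = ('D_u F z).1.
Proof.
apply: (derive_linear_comp (L := fst : {linear V -> 'M[R]_(m, 4)})).
  by move=> x; exact: cvg_fst.
exact: smooth_differentiable.
Qed.

Lemma derive_snd : 'D_u (fun y => (F y).2) z = ('D_u F z).2.
Proof.
apply: (derive_linear_comp (L := snd : {linear V -> 'rV[R]_4})).
  by move=> x; exact: cvg_snd.
exact: smooth_differentiable.
Qed.

End DeriveForms.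

Section DeriveMetricForm.
Context {R : realType} {m : nat}.
Local Notation V := ('M[R]_(m, 4) * 'rV[R]_4)%type.
Implicit Types (X Y : V -> V) (z u : V).

Lemma is_derive_eta1 X z u (a : 'rV[R]_4) : smooth X ->
  is_derive z u (fun y => eta a y.1 (X y).1)
    (eta a u.1 (X z).1 + eta a z.1 ('D_u X z).1).
Proof.
move=> sX; have sX1 := smooth_fst sX; have s1 := smooth_fst (@smooth_id _ V).
rewrite -derive_fst // -[u in eta a u.1](@derive_id _ V z) -derive_fst; last exact: smooth_id.
rewrite -derive_eta //; apply/derivableP/smooth_derivable; exact: smooth_eta.
Qed.

Lemma is_derive_eta2 X z u (a : 'rV[R]_4) : smooth X ->
  is_derive z u (fun y => eta a y.2 (X y).2)
    (eta a u.2 (X z).2 + eta a z.2 ('D_u X z).2).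
Proof.
move=> sX; have sX1 := smooth_snd sX; have s1 := smooth_snd (@smooth_id _ V).
rewrite -derive_snd // -[u in eta a u.2](@derive_id _ V z) -derive_snd; last exact: smooth_id.
rewrite -derive_eta //; apply/derivableP/smooth_derivable; exact: smooth_eta.
Qed.

(** The [dot] terms have constant coefficients: moving the base point affects only the forms [eta],
    which gives [dmform]. *)
Lemma derive_mform (a b d e f : R) X Y z u : smooth X -> smooth Y ->
  'D_u (fun y => mform a b d e f y (X y) (Y y)) z
    = dmform b e f z u (X z) (Y z) + mform a b d e f z ('D_u X z) (Y z)
      + mform a b d e f z (X z) ('D_u Y z).
Proof.
move=> sX sY.
have d1 : is_derive z u (fun y => dot (X y).1 (Y y).1)
    (dot ('D_u X z).1 (Y z).1 + dot (X z).1 ('D_u Y z).1).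
  have [sX1 sY1] := (smooth_fst sX, smooth_fst sY).
  apply: is_derive_eq (derivableP (smooth_derivable (smooth_dot sX1 sY1))) _.
  by rewrite (derive_dot z u sX1 sY1) (derive_fst z u sX) (derive_fst z u sY).
have d2 : is_derive z u (fun y => dot (X y).2 (Y y).2)
    (dot ('D_u X z).2 (Y z).2 + dot (X z).2 ('D_u Y z).2).
  have [sX2 sY2] := (smooth_snd sX, smooth_snd sY).
  apply: is_derive_eq (derivableP (smooth_derivable (smooth_dot sX2 sY2))) _.
  by rewrite (derive_dot z u sX2 sY2) (derive_snd z u sX) (derive_snd z u sY).
have d1X c := is_derive_eta1 z u c sX; have d1Y c := is_derive_eta1 z u c sY.
have d2X c := is_derive_eta2 z u c sX; have d2Y c := is_derive_eta2 z u c sY.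
rewrite /mform; apply: derive_val; apply: is_derive_eq.
have sc (x y : R) : x *: (y : (R : normedModType R)) = x * y by [].
rewrite !sc /dmform.
have alg (dX1 dY1 dX2 dY2 jX jY uX uY eX eY iX iY vX vY gX gY kX kY wX wY hX hY
    fX fY lX lY nX nY : R) :
    a * (dX1 + dY1) + b * (jX * (uY + eY) + jY * (uX + eX)) + d * (dX2 + dY2)
    + e * (iX * (lY + nY) + fY * (vX + gX) + (fX * (vY + gY) + iY * (lX + nX)))
    + f * (kX * (lY + nY) + fY * (wX + hX) + (fX * (wY + hY) + kY * (lX + nX)))
  = b * (uX * jY + jX * uY)
    + e * (vX * fY + iX * lY + (lX * iY + fX * vY))
    + f * (wX * fY + kX * lY + (lX * kY + fX * wY))
    + (a * dX1 + b * (eX * jY) + d * dX2 + e * (gX * fY + nX * iY)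
       + f * (hX * fY + nX * kY))
    + (a * dY1 + b * (jX * eY) + d * dY2 + e * (iX * nY + fX * gY)
       + f * (kX * nY + fX * hY)) by ring.
exact: alg.
Qed.

End DeriveMetricForm.

Section RotI.
Context {R : realType} {m : nat}.
Implicit Types x y : 'M[R]_(m, 4).

(** For [y] tangent at [x], the right multiplication by i of the component of [y] orthogonal to x i.
    On the factor S^3 this component is the part along v_2 and v_3. *)
Definition rot_i x y := qmul y qi + eta qi x y *: x.

Lemma rot_i_gram x y : dot x x = 1 -> dot x y = 0 ->
  [/\ dot x (rot_i x y) = 0, eta qi x (rot_i x y) = 0,
      dot (rot_i x y) (rot_i x y) = dot y y - eta qi x y ^+ 2 &
      dot (qmul y qi) (rot_i x y) = dot y y - eta qi x y ^+ 2].
Proof.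
move=> xx xy; have [[ii _ _ _ _] _] := @dot_units R.
have e' : dot x (qmul y qi) = - eta qi x y.
  by rewrite dotC -[LHS]/(eta qi y x) eta_antisym // qi0.
have h0 : dot x (rot_i x y) = 0.
  by rewrite /rot_i dotDr dotZr e' xx mulr1 addNr.
have hi : eta qi x (rot_i x y) = 0.
  by rewrite /rot_i etaDr etaZr eta_i_qi xy eta_self ?qi0 // mulr0 addr0.
have hy : dot (qmul y qi) (rot_i x y) = dot y y - eta qi x y ^+ 2.
  by rewrite /rot_i dotDr dotZr dot_qmul ii [dot _ x]dotC e'; ring.
by split=> //; rewrite {1}/rot_i dotDl dotZl hy h0 mulr0 addr0.
Qed.

End RotI.

Lemma sum6_le0 (R : realDomainType) (a1 a2 a3 a4 a5 a6 : R) :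
  0 <= a1 -> 0 <= a2 -> 0 <= a3 -> 0 <= a4 -> 0 <= a5 -> 0 <= a6 ->
  a1 + a2 + a3 + a4 + a5 + a6 <= 0 ->
  [/\ a1 = 0, a2 = 0, a3 = 0 & [/\ a4 = 0, a5 = 0 & a6 = 0]].
Proof. by move=> *; split; [lra|lra|lra|split; lra]. Qed.

(* [c], [mu], [k] stand for [sqrt (A C) / 2], [2 / A], [2 / D]; the hypothesis
   [mu * c < 1] is [C < A]. *)
Section Geometry.
Context {R : realType} {m : nat}.
Local Notation V := ('M[R]_(m, 4) * 'rV[R]_4)%type.
Local Notation M := (@prodM R m).
Local Notation TM := (@prodTM R m).
Variables (c mu k p q : R).
Hypotheses (c_gt0 : 0 < c) (mu_gt0 : 0 < mu) (k_gt0 : 0 < k) (muc : mu * c < 1).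
Hypotheses (p_neq0 : p != 0) (q_neq0 : q != 0) (pq_lt1 : p ^+ 2 + q ^+ 2 < 1).
Implicit Types (x y v w z : V).

Let N := mu ^+ 2 - c ^- 2.
Local Notation G := (mform (c ^- 2) N (k ^+ 2) (p * k / c) (q * k / c)).
Local Notation T := (fun z : V => (c *: qmul z.1 qi, 0) : V).

Let c0 : c != 0. Proof. by rewrite gt_eqF. Qed.
Let k0 : k != 0. Proof. by rewrite gt_eqF. Qed.
Let mu0 : mu != 0. Proof. by rewrite gt_eqF. Qed.

(** For [v] tangent at [x], [hor_sq] and [rot_sq] are round squared norms: of the part of the first
    component orthogonal to the quaternionic line, and of the part of the second along x j and x
    k. *)
Definition hor_sq x v := dot v.1 v.1 - eta qi x.1 v.1 ^+ 2 - eta qj x.1 v.1 ^+ 2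
  - eta qk x.1 v.1 ^+ 2.
Definition rot_sq x v := dot v.2 v.2 - eta qi x.2 v.2 ^+ 2.

Lemma hor_sq_ge0 x v : M x -> TM x v -> 0 <= hor_sq x v.
Proof.
rewrite /hor_sq; move=> [x1 x2] [v1 v2]; have [[_ _ _ _ <-] _] := hor_i_gram x1 v1.
exact: dot_ge0.
Qed.

Lemma rot_sq_ge0 x v : M x -> TM x v -> 0 <= rot_sq x v.
Proof.
rewrite /rot_sq; move=> [x1 x2] [v1 v2]; have [_ _ <- _] := rot_i_gram x2 v2.
exact: dot_ge0.
Qed.

(** Completing the squares in beta_1 and beta_3 leaves sigma_1^2 with the coefficient 1 - p^2 - q^2,
    whose positivity is the hypothesis on p and q. *)
Lemma G_squares x v : G x v v = hor_sq x v / c ^+ 2 + mu ^+ 2 * eta qj x.1 v.1 ^+ 2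
  + k ^+ 2 * rot_sq x v + (eta qi x.1 v.1 / c + p * k * eta qi x.2 v.2) ^+ 2
  + (eta qk x.1 v.1 / c + q * k * eta qi x.2 v.2) ^+ 2
  + (1 - p ^+ 2 - q ^+ 2) * k ^+ 2 * eta qi x.2 v.2 ^+ 2.
Proof.
rewrite /mform /hor_sq /rot_sq /N.
move: (dot v.1 v.1) (dot v.2 v.2) (eta qi x.1 v.1) (eta qj x.1 v.1) (eta qk x.1 v.1)
  (eta qi x.2 v.2) => d1 d2 ei ej ek f.
by field.
Qed.

Lemma tangent_eq0 x v : M x -> TM x v ->
  hor_sq x v = 0 -> rot_sq x v = 0 -> eta qi x.1 v.1 = 0 -> eta qj x.1 v.1 = 0 ->
  eta qk x.1 v.1 = 0 -> eta qi x.2 v.2 = 0 -> v = 0.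
Proof.
rewrite /hor_sq /rot_sq => Mx tv + + ei ej ek f.
rewrite ei ej ek f expr0n !subr0 => d1 d2.
by rewrite [v]surjective_pairing (dot_eq0 d1) (dot_eq0 d2).
Qed.

Lemma G_gt0 x v : M x -> TM x v -> v != 0 -> 0 < G x v v.
Proof.
move=> Mx tv; apply: contraNT; rewrite -leNgt G_squares => le0.
have h1 := hor_sq_ge0 Mx tv; have h2 := rot_sq_ge0 Mx tv.
have pq0 : 0 < 1 - p ^+ 2 - q ^+ 2 by rewrite -addrA -opprD subr_gt0.
have c2 : 0 < c ^+ 2 by rewrite exprn_gt0.
have k2 : 0 < k ^+ 2 by rewrite exprn_gt0.
have mu2 : 0 < mu ^+ 2 by rewrite exprn_gt0.
have t1 : 0 <= hor_sq x v / c ^+ 2 by rewrite divr_ge0 // ltW.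
have t2 : 0 <= mu ^+ 2 * eta qj x.1 v.1 ^+ 2 by rewrite mulr_ge0 ?sqr_ge0.
have t3 : 0 <= k ^+ 2 * rot_sq x v by rewrite mulr_ge0 ?sqr_ge0.
have t4 := sqr_ge0 (eta qi x.1 v.1 / c + p * k * eta qi x.2 v.2).
have t5 := sqr_ge0 (eta qk x.1 v.1 / c + q * k * eta qi x.2 v.2).
have t6 : 0 <= (1 - p ^+ 2 - q ^+ 2) * k ^+ 2 * eta qi x.2 v.2 ^+ 2.
  by rewrite mulr_ge0 ?sqr_ge0 // mulr_ge0 ?sqr_ge0 // ltW.
have [z1 z2 z3 [z4 z5 z6]] := sum6_le0 t1 t2 t3 t4 t5 t6 le0.
have f0 : eta qi x.2 v.2 = 0.
  by move/eqP: z6; rewrite !mulf_eq0 !orbb (gt_eqF pq0) (negPf k0) => /eqP.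
have e0 (a : R) : a / c + 0 = 0 -> a = 0.
  by rewrite addr0 => /eqP; rewrite mulf_eq0 invr_eq0 (negPf c0) orbF => /eqP.
have ei : eta qi x.1 v.1 = 0.
  by move/eqP: z4; rewrite expf_eq0 /= f0 mulr0 => /eqP; exact: e0.
have ek : eta qk x.1 v.1 = 0.
  by move/eqP: z5; rewrite expf_eq0 /= f0 mulr0 => /eqP; exact: e0.
have ej : eta qj x.1 v.1 = 0.
  by move/eqP: z2; rewrite mulf_eq0 !expf_eq0 /= (negPf mu0) /= => /eqP.
apply/eqP; apply: (tangent_eq0 Mx tv) => //.
- by move/eqP: z1; rewrite mulf_eq0 invr_eq0 expf_eq0 /= (negPf c0) orbF => /eqP.
- by move/eqP: z3; rewrite mulf_eq0 expf_eq0 /= (negPf k0) /= => /eqP.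
Qed.

Lemma G_riemannian : riemannian_metric M TM G.
Proof.
split=> [x _ v w _ _|x _ a v v' w _ _ _|x Mx v|X Y [sX _] [sY _]].
- exact: mformC.
- exact: mformPl.
- exact: G_gt0.
- by apply: mform_smooth => //; exact: smooth_id.
Qed.

Lemma T_linear a v w : T (a *: v + w) = a *: T v + T w.
Proof.
congr (_, _); rewrite /= ?scaler0 ?addr0 //.
by rewrite qmul_linear scalerDr !scalerA mulrC.
Qed.

Lemma T_field : vector_field M TM T.
Proof.
split.
  apply: smooth_pair; last exact: smooth_cst.
  apply: (@smoothZ _ _ _ (fun=> c)); first exact: smooth_cst.
  by apply: smooth_qmul; exact/smooth_fst/smooth_id.
move=> x _; split; rewrite /sphere_tangent /= ?dot0r // dotZr dotC.
by rewrite -[dot _ _]/(eta qi x.1 x.1) eta_self ?qi0 // mulr0.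
Qed.

(* The value of [g (nabla_Y T, Z)] at [x], where [Y x = y] and [Z x = z]. *)
Definition shape x y z : R := dot (qmul y.1 qi) z.1 / c
  + N * c * (eta qk x.1 y.1 * eta qj x.1 z.1 + eta qj x.1 y.1 * eta qk x.1 z.1)
  + p * k * dot (qmul y.2 qi) z.2
  - q * k * (eta qj x.1 y.1 * eta qi x.2 z.2 + eta qi x.2 y.2 * eta qj x.1 z.1).

(** The left side is what remains of the Koszul formula after the derivatives of [Y] and [Z] have
    cancelled against the brackets. The last term comes from the derivative of [T], which is [T]
    itself since [T] is linear. *)
Lemma koszul_shape x y z : M x -> TM x y -> TM x z ->
  dmform N (p * k / c) (q * k / c) x y (T x) z
  + dmform N (p * k / c) (q * k / c) x (T x) y z
  - dmform N (p * k / c) (q * k / c) x z y (T x) + 2 * G x (T y) z = 2 * shape x y z.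
Proof.
move=> [x1 x2] [y1 y2] [z1 z2]; rewrite /dmform /mform /shape /=.
have e0 a n (u : 'M[R]_(n, 4)) : eta a u 0 = 0 :> R by exact: dot0r.
have e0' a n (u : 'M[R]_(n, 4)) : eta a 0 u = 0 :> R.
  by rewrite -(scale0r 0) etaZl mul0r.
have d0 n (u : 'M[R]_(n, 4)) : dot 0 u = 0 :> R by rewrite dotC dot0r.
rewrite !etaZr !etaZl !dotZl !e0 !e0' !d0.
rewrite !eta_i_qi !eta_j_qi !eta_k_qi !eta_qi_i !eta_qi_j !eta_qi_k.
rewrite ![eta _ x.1 x.1]eta_self ?qj0 ?qk0 // x1 y1 z1 (dotC y.1 x.1) (dotC z.1 x.1) y1 z1.
rewrite ![eta _ y.1 x.1]eta_antisym ?qj0 ?qk0 //.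
rewrite ![eta _ z.1 x.1]eta_antisym ?qj0 ?qk0 //.
rewrite -[dot (qmul y.2 qi) _]/(eta qi y.2 z.2) -[dot (qmul y.1 qi) _]/(eta qi y.1 z.1).
rewrite (eta_antisym y.2 z.2) ?qi0 //.
move: (eta qi y.1 z.1) (eta qi y.2 z.2) (eta qj x.1 y.1) (eta qk x.1 y.1)
 (eta qj x.1 z.1) (eta qk x.1 z.1) (eta qi x.2 y.2) (eta qi x.2 z.2).
move=> a1 a2 a3 a4 a5 a6 a7 a8.
by field.
Qed.

End Geometry.

(** * Positivity of the mixed curvature *)

Section Curvature.
Context {R : realType} {m : nat}.
Local Notation V := ('M[R]_(m, 4) * 'rV[R]_4)%type.
Local Notation M := (@prodM R m).
Local Notation TM := (@prodTM R m).
Variables (c mu k p q : R).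
Hypotheses (c_gt0 : 0 < c) (mu_gt0 : 0 < mu) (k_gt0 : 0 < k) (muc : mu * c < 1).
Hypotheses (p_neq0 : p != 0) (q_neq0 : q != 0) (pq_lt1 : p ^+ 2 + q ^+ 2 < 1).
Implicit Types (x y v w z : V) (X Y Z : V -> V).

Let N := mu ^+ 2 - c ^- 2.
Local Notation G := (mform (c ^- 2) N (k ^+ 2) (p * k / c) (q * k / c)).
Local Notation T := (fun z : V => (c *: qmul z.1 qi, 0) : V).
Local Notation S := (shape c mu k p q).
Variable nabla : (V -> V) -> (V -> V) -> V -> V.
Hypothesis LC : levi_civita M TM G nabla.
Local Notation vf := (vector_field M TM).

Let c0 : c != 0. Proof. by rewrite gt_eqF. Qed.
Let k0 : k != 0. Proof. by rewrite gt_eqF. Qed.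
Let mu0 : mu != 0. Proof. by rewrite gt_eqF. Qed.
Let gM : riemannian_metric M TM G.
Proof. exact: G_riemannian. Qed.
Let TMl x (a : R) v w : M x -> TM x v -> TM x w -> TM x (a *: v + w).
Proof. by move=> _; exact: prodTM_linear. Qed.
Let TM0 x : M x -> TM x 0.
Proof. by move=> _; exact: prodTM0. Qed.
Let derive_along_smooth (X : V -> V) (f : V -> R) :
  smooth X -> smooth f -> smooth (fun x => 'D_(X x) f x).
Proof. exact: (smooth_derive_field (@coordf_continuous R m) (@sum_coordf R m)). Qed.
Let bracket_smooth (X Y : V -> V) : smooth X -> smooth Y -> smooth (bracket X Y).
Proof. exact: (smooth_bracket (@coordf_continuous R m) (@sum_coordf R m)). Qed.
Let derive_along_bracket (X Y : V -> V) (f : V -> R) x :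
  smooth X -> smooth Y -> smooth f ->
  'D_(X x) (fun y => 'D_(Y y) f y) x - 'D_(Y x) (fun y => 'D_(X y) f y) x
    = 'D_(bracket X Y x) f x.
Proof. exact: (derive_bracket (@coordf_continuous R m) (@sum_coordf R m)). Qed.

Lemma derive_T x v : 'D_v T x = T v.
Proof. by apply: derive_linear => a u w; exact: T_linear. Qed.

Lemma nabla_T Y Z x : vf Y -> vf Z -> M x ->
  G x (nabla Y T x) (Z x) = S x (Y x) (Z x).
Proof.
move=> vY vZ Mx; have vT := @T_field R m c.
have [[sY tY] [sZ tZ] [sT tT]] := And3 vY vZ vT.
have D X Y' u := @derive_mform R m (c ^- 2) N (k ^+ 2) (p * k / c) (q * k / c) X Y' x u.
have B (u v w : V) : G x (u - v) w = G x u w - G x v w by exact: mformBl.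
have C (v w : V) : G x v w = G x w v by exact: mformC.
(* Rewriting with these identities would make unification unfold [derive]. *)
have alg (n d1 d2 d3 b1 b2 b3 m1 m2 m3 e yt_z t_yz ty_z y_tz zy_t y_zt yz_t tz_y
    zt_y s : R) :
    2 * n = d1 + d2 - d3 + b1 - b2 - b3 ->
    d1 = m1 + yt_z + t_yz -> d2 = m2 + ty_z + y_tz -> d3 = m3 + zy_t + y_zt ->
    b1 = yt_z - ty_z -> b2 = yz_t - zy_t -> b3 = tz_y - zt_y ->
    t_yz = yz_t -> y_tz = tz_y -> y_zt = zt_y -> yt_z = e ->
    m1 + m2 - m3 + 2 * e = 2 * s -> n = s.
  by lra.
apply: (alg _ _ _ _ _ _ _ _ _ _ _ _ _ _ _ _ _ _ _ _ _ (koszul gM LC vY vT vZ Mx)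
  (D T Z (Y x) sT sZ) (D Y Z (T x) sY sZ) (D Y T (Z x) sY sT)
  (B _ _ _) (B _ _ _) (B _ _ _) (C _ _) (C _ _) (C _ _) _
  (koszul_shape mu k p q c_gt0 Mx (tY x Mx) (tZ x Mx))).
by rewrite (derive_T x (Y x)).
Qed.

(** For y = T x the shape form vanishes on every tangent vector: x i i = -x is normal to the sphere,
    and [T] has no component in the directions j and k nor along S^3. *)
Lemma nabla_TT x : M x -> nabla T T x = 0.
Proof.
move=> Mx; have vT := @T_field R m c.
have vTT := nabla_vf LC vT vT.
have tTT := nabla_tangent LC Mx vT vT.
apply: (metric_eq0 gM Mx tTT); rewrite nabla_T //.
have [x1 x2] := Mx; have [t1 t2] := tTT.
rewrite /shape /= !etaZr !qmulZl !dotZl !eta_qmul x1.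
rewrite -[dot (qmul (qmul x.1 qi) qi) _]/(eta qi (qmul x.1 qi) _) eta_qi_i t1.
have [[_ _ _ ij ik] _] := @dot_units R.
rewrite (dotC qj) ij (dotC qk) ik.
have -> : eta qi x.2 0 = 0 :> R by exact: dot0r.
have -> : qmul (0 : 'rV[R]_4) qi = 0 by rewrite -[X in qmul X _](scale0r 0) qmulZl scale0r.
by rewrite [dot 0 _]dotC dot0r !(oppr0, mulr0, mul0r, addr0, subr0).
Qed.


(** The last two terms come from the motion of the base point: along [T] the forms eta_j and eta_k
    rotate into c eta_k and -c eta_j, while the forms on S^3 stay fixed. *)
Lemma derive_shape Y x : vf Y -> M x ->
  'D_(T x) (fun y => S y (Y y) (Y y)) x
    = S x ('D_(T x) Y x) (Y x) + S x (Y x) ('D_(T x) Y x)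
      + 2 * N * c ^+ 2 * (eta qk x.1 (Y x).1 ^+ 2 - eta qj x.1 (Y x).1 ^+ 2)
      - 2 * q * k * c * (eta qk x.1 (Y x).1 * eta qi x.2 (Y x).2).
Proof.
move=> [sY tY] Mx.
(* On the diagonal the two [dot] terms vanish, as w i is orthogonal to w. *)
have SE y w : S y w w = 2 * N * c * (eta qk y.1 w.1 * eta qj y.1 w.1)
    - 2 * q * k * (eta qj y.1 w.1 * eta qi y.2 w.2).
  rewrite /shape -[dot (qmul w.1 qi) _]/(eta qi w.1 w.1).
  by rewrite -[dot (qmul w.2 qi) _]/(eta qi w.2 w.2) !eta_self ?qi0 // /N; ring.
have -> : (fun y => S y (Y y) (Y y)) = (fun y =>
    2 * N * c * (eta qk y.1 (Y y).1 * eta qj y.1 (Y y).1)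
    - 2 * q * k * (eta qj y.1 (Y y).1 * eta qi y.2 (Y y).2)).
  by apply/funext => y; rewrite SE.
have d1 a := is_derive_eta1 x (T x) a sY; have d2 a := is_derive_eta2 x (T x) a sY.
apply: derive_val; apply: is_derive_eq.
have sc (a b : R) : a *: (b : (R : normedModType R)) = a * b by [].
rewrite !sc /= !etaZl eta_qi_j eta_qi_k (_ : eta qi 0 (Y x).2 = 0); last first.
  by rewrite -(scale0r 0) etaZl mul0r.
rewrite /shape (_ : dot (qmul (Y x).1 qi) ('D_(T x) Y x).1
                    = - dot (qmul ('D_(T x) Y x).1 qi) (Y x).1); last first.
  exact: (eta_antisym (a := qi)) qi0.
rewrite (_ : dot (qmul (Y x).2 qi) ('D_(T x) Y x).2
             = - dot (qmul ('D_(T x) Y x).2 qi) (Y x).2); last first.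
  exact: (eta_antisym (a := qi)) qi0.
have alg (n ek ej f ek' ej' f' a1 a2 : R) :
    2 * n * c * (ek * (c * ek + ej') + ej * (c * - ej + ek'))
    - 2 * q * k * (ej * (0 + f') + f * (c * ek + ej'))
  = a1 / c + n * c * (ek' * ej + ej' * ek) + p * k * a2 - q * k * (ej' * f + f' * ej)
    + (- a1 / c + n * c * (ek * ej' + ej * ek') + p * k * - a2
       - q * k * (ej * f' + f * ej'))
    + 2 * n * c ^+ 2 * (ek ^+ 2 - ej ^+ 2) - 2 * q * k * c * (ek * f) by ring.
exact: alg.
Qed.

Lemma shapeBl x u v z : S x (u - v) z = S x u z - S x v z.
Proof.
have qB n (y w : 'M[R]_(n, 4)) a : qmul (y - w) a = qmul y a - qmul w a.
  by rewrite addrC -scaleN1r qmul_linear scaleN1r addrC.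
by rewrite /shape /= !qB /eta !dotBl !dotBr; ring.
Qed.

Lemma shapeBr x u v z : S x z (u - v) = S x z u - S x z v.
Proof. by rewrite /shape /= /eta !dotBr; ring. Qed.

Lemma shape_T x y : TM x y -> S x y (T y) + S x (T y) y
  = 2 * N * c ^+ 2 * (eta qk x.1 y.1 ^+ 2 - eta qj x.1 y.1 ^+ 2)
    - 2 * q * k * c * (eta qk x.1 y.1 * eta qi x.2 y.2).
Proof.
move=> [y1 y2]; have [[ii _ _ _ _] _] := @dot_units R.
have e0 : eta qi x.2 0 = 0 :> R by exact: dot0r.
have q0 : qmul (0 : 'rV[R]_4) qi = 0 by rewrite -[X in qmul X _](scale0r 0) qmulZl scale0r.
rewrite /shape /= qmulZl !etaZr !dotZr !dotZl e0 q0 dot0r (dotC 0) dot0r.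
rewrite !eta_j_qi !eta_k_qi dot_qmul ii.
rewrite -[dot (qmul (qmul _ _) _) _]/(eta qi (qmul y.1 qi) y.1) eta_qi_i.
have alg (n ek ej f d : R) :
    c * (d * 1) / c + n * c * (ek * (c * ek) + ej * (c * - ej)) + p * k * 0
    - q * k * (ej * 0 + f * (c * ek))
    + (c * - d / c + n * c * (c * - ej * ej + c * ek * ek) + p * k * 0
       - q * k * (c * ek * f + 0 * ej))
  = 2 * n * c ^+ 2 * (ek ^+ 2 - ej ^+ 2) - 2 * q * k * c * (ek * f) by ring.
exact: alg.
Qed.

Lemma shape_smooth Y : vf Y -> smooth (fun y => S y (Y y) (Y y)).
Proof.
move=> [sY _]; rewrite /shape.
have [s1 s2] := (smooth_fst (@smooth_id _ V), smooth_snd (@smooth_id _ V)).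
have [Y1 Y2] := (smooth_fst sY, smooth_snd sY).
have cst t : smooth (fun _ : V => t : R) by exact: smooth_cst.
by do ?[exact: cst|apply: smoothD|apply: smoothN|apply: smoothM|apply: smooth_eta
       |apply: smooth_dot|apply: smooth_qmul].
Qed.

(** Since [T, Y] = D_T Y - T Y, the derivatives of [Y] in the bracket terms cancel those in
    [derive_shape]. The base-point terms there and the value of [shape_T] are equal and enter with
    the same sign, which doubles the coefficients 2 to 4. *)
Lemma curvature_T Y x : vf Y -> M x ->
  G x (curvature nabla T Y Y x) (T x)
    = G x (nabla Y T x) (nabla Y T x)
      - 4 * N * c ^+ 2 * (eta qk x.1 (Y x).1 ^+ 2 - eta qj x.1 (Y x).1 ^+ 2)
      + 4 * q * k * c * (eta qk x.1 (Y x).1 * eta qi x.2 (Y x).2).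
Proof.
move=> vY Mx; have vT := @T_field R m c; have [_ tY] := vY.
have vb : vf (bracket T Y) := bracket_vf TMl TM0 bracket_smooth LC vT vY.
have mc := mixed_curvature TMl TM0 (@prod_derive_local R m) derive_along_smooth
  bracket_smooth derive_along_bracket gM LC vT nabla_TT Mx vY.
have tT : TM x (T x) by case: vT => _; exact.
have D : 'D_(T x) (fun y => G y (nabla Y T y) (Y y)) x
    = 'D_(T x) (fun y => S y (Y y) (Y y)) x.
  apply: prod_derive_local => //; last by move=> y My; exact: nabla_T.
    by apply: (metric_smooth gM) => //; exact: (nabla_vf LC).
  exact: shape_smooth.
have B1 := nabla_T vY vb Mx; have B2 := nabla_T vb vY Mx.
have C1 : S x (Y x) (bracket T Y x) = S x (Y x) ('D_(T x) Y x) - S x (Y x) (T (Y x)).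
  by rewrite -(derive_T x (Y x)); exact: shapeBr.
have C2 : S x (bracket T Y x) (Y x) = S x ('D_(T x) Y x) (Y x) - S x (T (Y x)) (Y x).
  by rewrite -(derive_T x (Y x)); exact: shapeBl.
have alg (lhs s2 b1 b2 dg ds yd yt dy ty h e1 e2 : R) :
    lhs = s2 + b1 + b2 - dg -> dg = ds -> b1 = yd - yt -> b2 = dy - ty ->
    ds = dy + yd + 2 * N * c ^+ 2 * e1 - 2 * q * k * c * e2 ->
    yt + ty = 2 * N * c ^+ 2 * e1 - 2 * q * k * c * e2 ->
    lhs = s2 - 4 * N * c ^+ 2 * e1 + 4 * q * k * c * e2 by lra.
exact: (alg _ _ _ _ _ _ _ _ _ _ 0 _ _ mc D (etrans B1 C1) (etrans B2 C2)
  (derive_shape vY Mx) (shape_T (tY x Mx))).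
Qed.

Lemma G_ge0 x v : M x -> TM x v -> 0 <= G x v v.
Proof.
move=> Mx tv; have [->|v0] := eqVneq v 0; last exact/ltW/G_gt0.
by rewrite (metric0l TM0 gM Mx) //; exact: TM0.
Qed.

(* Equal to [nabla_Y T] for [Y x = y] but for the components along [u_3] and
   [v_1 - p T], where the exact value would only improve the lower bound for
   [|nabla_Y T|^2]. *)
Definition comparison x y : V :=
  (((c * eta qk x.1 y.1 - q * k * eta qi x.2 y.2 / mu ^+ 2) *: qmul x.1 qj
    + ((N * c - c^-1) * c ^+ 2 * eta qj x.1 y.1) *: qmul x.1 qk
    + c *: hor_i x.1 y.1),
   (p / k) *: rot_i x.2 y.2).

Lemma comparison_tangent x y : M x -> TM x y -> TM x (comparison x y).
Proof.
move=> [x1 x2] [y1 y2].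
have [[h _ _ _ _] _] := hor_i_gram x1 y1; have [r _ _ _] := rot_i_gram x2 y2.
split; rewrite /sphere_tangent /= ?dotDr !dotZr ?h ?r ?mulr0 //.
rewrite [dot _ (qmul _ qj)]dotC [dot _ (qmul _ qk)]dotC.
rewrite -[dot (qmul _ qj) _]/(eta qj x.1 x.1) -[dot (qmul _ qk) _]/(eta qk x.1 x.1).
by rewrite !eta_self ?qj0 ?qk0 // !mulr0 !addr0.
Qed.

(** The coefficients of z = [comparison x y] are the values of the shape form on the corresponding
    unit vectors. Hence [S x y z] and [G x z z] coincide, and both equal the right-hand side. *)
Lemma comparison_bound x y : M x -> TM x y ->
  2 * S x y (comparison x y) - G x (comparison x y) (comparison x y)
  = hor_sq x y + p ^+ 2 * rot_sq x y
    + mu ^+ 2 * (c * eta qk x.1 y.1 - q * k * eta qi x.2 y.2 / mu ^+ 2) ^+ 2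
    + (N * c - c^-1) ^+ 2 * c ^+ 2 * eta qj x.1 y.1 ^+ 2.
Proof.
move=> [x1 x2] [y1 y2].
have [[_ hi hj hk hh] hy] := hor_i_gram x1 y1.
have [_ ri rr ry] := rot_i_gram x2 y2.
have [[ii jj kk ij ik] jk] := @dot_units R.
rewrite G_squares // /comparison.
set al := (c * _ - _); set be := ((N * c - _) * _ * _).
set z := (X in shape _ _ _ _ _ _ _ X).
have ei : eta qi x.1 z.1 = 0.
  by rewrite /= !etaDr !etaZr !eta_qmul ij ik hi !mulr0 !addr0.
have ej : eta qj x.1 z.1 = al.
  by rewrite /= !etaDr !etaZr !eta_qmul jj jk hj x1 !(mulr0, addr0) !mulr1.
have ek : eta qk x.1 z.1 = be.
  by rewrite /= !etaDr !etaZr !eta_qmul (dotC qk) jk kk hk x1 !(mulr0, addr0, add0r) !mulr1.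
have f0 : eta qi x.2 z.2 = 0 by rewrite /= etaZr ri mulr0.
have hz : hor_sq x z = c ^+ 2 * hor_sq x y.
  have j1 : dot (qmul x.1 qj) (hor_i x.1 y.1) = 0 := hj.
  have k1 : dot (qmul x.1 qk) (hor_i x.1 y.1) = 0 := hk.
  rewrite {1}/hor_sq ei ej ek /= !dotDr !dotDl !dotZr !dotZl !dot_qmul.
  by rewrite !(dotC (hor_i _ _)) j1 k1 hh (dotC qk) jj kk jk x1 /hor_sq; ring.
have rz : rot_sq x z = (p / k) ^+ 2 * rot_sq x y.
  by rewrite /rot_sq f0 /= dotZr dotZl rr; ring.
have d1 : dot (qmul y.1 qi) z.1 = al * eta qk x.1 y.1 - be * eta qj x.1 y.1 + c * hor_sq x y.
  rewrite /= !dotDr !dotZr hy /hor_sq ![dot (qmul y.1 qi) (qmul _ _)]dotC.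
  rewrite -[dot (qmul x.1 qj) _]/(eta qj x.1 (qmul y.1 qi)).
  rewrite -[dot (qmul x.1 qk) _]/(eta qk x.1 (qmul y.1 qi)).
  by rewrite eta_j_qi eta_k_qi; ring.
have d2 : dot (qmul y.2 qi) z.2 = (p / k) * rot_sq x y by rewrite /= dotZr ry.
rewrite /shape d1 d2 hz rz ei ej ek f0 /al /be /N.
move: (hor_sq x y) (rot_sq x y) (eta qj x.1 y.1) (eta qk x.1 y.1) (eta qi x.2 y.2).
move=> h r a b f; field.
by rewrite c0 k0 mu0.
Qed.

(* The sum of the lower bound for [|nabla_Y T|^2] and of the remaining terms of
   the curvature is [h + p^2 r + (mu c)^4 a^2 + (mu c b + q k f / mu)^2
   + 4 (1 - mu^2 c^2) b^2]. *)
Lemma squares_eq0 (h r a b f s : R) : 0 <= h -> 0 <= r ->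
  h + p ^+ 2 * r + mu ^+ 2 * (c * b - q * k * f / mu ^+ 2) ^+ 2
    + (N * c - c^-1) ^+ 2 * c ^+ 2 * a ^+ 2 <= s ->
  s - 4 * N * c ^+ 2 * (b ^+ 2 - a ^+ 2) + 4 * q * k * c * (b * f) <= 0 ->
  [/\ h = 0, r = 0, a = 0, b = 0 & f = 0].
Proof.
move=> h0 r0 le_s le0.
have t2 : 0 <= p ^+ 2 * r by rewrite mulr_ge0 ?sqr_ge0.
have t3 : 0 <= ((mu * c) ^+ 2 * a) ^+ 2 by rewrite sqr_ge0.
have t4 : 0 <= (mu * c * b + q * k * f / mu) ^+ 2 by rewrite sqr_ge0.
have muc2 : 0 < 1 - (mu * c) ^+ 2.
  by rewrite subr_gt0 expr_lt1 // ltW // mulr_gt0.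
have t5 : 0 <= 4 * (1 - (mu * c) ^+ 2) * b ^+ 2.
  by rewrite mulr_ge0 ?sqr_ge0 // mulr_ge0 // ltW.
have sum_le0 : h + p ^+ 2 * r + ((mu * c) ^+ 2 * a) ^+ 2
    + (mu * c * b + q * k * f / mu) ^+ 2 + 4 * (1 - (mu * c) ^+ 2) * b ^+ 2 + 0 <= 0.
  apply: le_trans le0; rewrite -subr_ge0; move: le_s; rewrite -subr_ge0 => le_s.
  suff -> : s - 4 * N * c ^+ 2 * (b ^+ 2 - a ^+ 2) + 4 * q * k * c * (b * f)
    - (h + p ^+ 2 * r + ((mu * c) ^+ 2 * a) ^+ 2
    + (mu * c * b + q * k * f / mu) ^+ 2 + 4 * (1 - (mu * c) ^+ 2) * b ^+ 2 + 0)
    = s - (h + p ^+ 2 * r + mu ^+ 2 * (c * b - q * k * f / mu ^+ 2) ^+ 2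
    + (N * c - c^-1) ^+ 2 * c ^+ 2 * a ^+ 2) by [].
  rewrite /N; field.
  by rewrite c0 mu0.
have [z1 z2 z3 [z4 z5 _]] := sum6_le0 h0 t2 t3 t4 t5 (lexx 0) sum_le0.
(* C < A gives b = 0; only then does the mixed square isolate [f], where q enters, while p is what
   forces r = 0. *)
have b0 : b = 0.
  apply/eqP; move/eqP: z5; rewrite mulf_eq0 mulf_eq0 pnatr_eq0 (gt_eqF muc2) /=.
  by rewrite expf_eq0.
have a0 : a = 0.
  apply/eqP; move/eqP: z3; rewrite expf_eq0 /= mulf_eq0 expf_eq0 /= mulf_eq0.
  by rewrite (negPf mu0) (negPf c0).
have f0 : f = 0.
  apply/eqP; move/eqP: z4; rewrite expf_eq0 /= b0 mulr0 add0r !mulf_eq0 invr_eq0.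
  by rewrite (negPf q_neq0) (negPf k0) (negPf mu0) orbF.
split=> //; apply/eqP; move/eqP: z2.
by rewrite mulf_eq0 expf_eq0 /= (negPf p_neq0).
Qed.

Lemma mixed_curvature_gt0 Y x : vf Y -> M x -> G x (T x) (Y x) = 0 -> Y x != 0 ->
  0 < G x (curvature nabla T Y Y x) (T x).
Proof.
move=> vY Mx TY Y0; have [_ tY] := vY; have tYx := tY x Mx.
have vT := @T_field R m c.
set z := comparison x (Y x).
have tz : TM x z by exact: comparison_tangent.
have ts : TM x (nabla Y T x) := nabla_tangent LC Mx vY vT.
(* [nabla_T] pairs with a field, so the vector [z] is extended by tangential projection. *)
have Gsz : G x (nabla Y T x) z = S x (Y x) z.
  by have := nabla_T vY (tangent_proj_vf z) Mx; rewrite tangent_proj_id.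
(* This is the non-negativity of the squared norm of nabla_Y T - z. *)
have bound : 2 * S x (Y x) z - G x z z <= G x (nabla Y T x) (nabla Y T x).
  have tsz : TM x (nabla Y T x - z).
    by rewrite addrC -scaleN1r; exact: prodTM_linear.
  have := G_ge0 Mx tsz.
  rewrite mformBl [X in X - _]mformC [X in _ - X]mformC !mformBl (mformC _ _ _ _ _ _ z).
  by rewrite Gsz; lra.
rewrite curvature_T //; move: bound; rewrite comparison_bound // => bound.
(* The squares do not control the component of [Y] along u_1; orthogonality to [T] ties it to the
   sigma_1-component, which they do control. *)
have TYE : G x (T x) (Y x) = eta qi x.1 (Y x).1 / c + p * k * eta qi x.2 (Y x).2.
  have [[ii _ _ ij ik] _] := @dot_units R; have [x1 _] := Mx.
  have e0 : eta qi x.2 0 = 0 :> R by exact: dot0r.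
  rewrite /mform /= dotZl !etaZr !eta_qmul (dotC qj) (dotC qk) ii ij ik x1 e0.
  rewrite (dotC 0) dot0r.
  rewrite -[dot (qmul x.1 qi) _]/(eta qi x.1 (Y x).1).
  by move: (eta qi x.1 (Y x).1) (eta qj _ _) (eta qk _ _) (eta qi x.2 _) => *; field.
move: TY; rewrite TYE => TY.
have h1 := hor_sq_ge0 Mx tYx; have h2 := rot_sq_ge0 Mx tYx.
move: Y0; apply: contraNT => ngt; apply/eqP.
set ss := G x (nabla Y T x) (nabla Y T x) in bound ngt.
have eqs : [/\ hor_sq x (Y x) = 0, rot_sq x (Y x) = 0, eta qj x.1 (Y x).1 = 0,
    eta qk x.1 (Y x).1 = 0 & eta qi x.2 (Y x).2 = 0].
  move: h1 h2 bound ngt; rewrite -leNgt.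
  move: (hor_sq x (Y x)) (rot_sq x (Y x)) (eta qj x.1 (Y x).1) (eta qk x.1 (Y x).1)
    (eta qi x.2 (Y x).2) ss => h r a b f s h0 r0 bound le0.
  exact: (squares_eq0 h0 r0 bound le0).
have [e1 e2 e3 e4 e5] := eqs.
apply: (tangent_eq0 Mx tYx) => //.
move: TY; rewrite e5 mulr0 addr0 => /eqP.
by rewrite mulf_eq0 invr_eq0 (negPf c0) orbF => /eqP.
Qed.

End Curvature.

(** * The leaves *)

Section Curves.
Context {R : realType}.

Lemma is_derive_scale (c t : R) : is_derive t 1 ( *%R c) c.
Proof.
have D : is_derive t 1 (c *: (id : R -> R)) (c *: 1) by exact: is_deriveZ.
by apply: (is_derive_eq D); rewrite [LHS]mulr1.
Qed.

Lemma is_derive_cosM (c t : R) :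
  is_derive t 1 (fun s => cos (c * s)) (- c * sin (c * t)).
Proof.
apply: (is_derive_eq (is_derive1_comp (is_derive_cos (c * t)) (is_derive_scale c t))).
by rewrite mulrC mulrN mulNr.
Qed.

Lemma is_derive_sinM (c t : R) :
  is_derive t 1 (fun s => sin (c * s)) (c * cos (c * t)).
Proof.
apply: (is_derive_eq (is_derive1_comp (is_derive_sin (c * t)) (is_derive_scale c t))).
by rewrite mulrC.
Qed.

Lemma differentiable_cosM (c t : R) : differentiable (fun s : R => cos (c * s)) t.
Proof. by apply/derivable1_diffP; have [] := is_derive_cosM c t. Qed.

Lemma differentiable_sinM (c t : R) : differentiable (fun s : R => sin (c * s)) t.
Proof. by apply/derivable1_diffP; have [] := is_derive_sinM c t. Qed.

(** Combinations of the two functions are closed under differentiation, so the induction on the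
    order runs over arbitrary coefficients. *)
Lemma smooth_trig (c : R) :
  smooth (fun s : R => cos (c * s)) /\ smooth (fun s : R => sin (c * s)).
Proof.
have dE (f : R -> R) (t v : R) : differentiable f t -> 'D_v f t = v * 'D_1 f t.
  move=> df; rewrite !deriveE // [in LHS](_ : v = v *: (1 : R)); last by rewrite [RHS]mulr1.
  by rewrite linearZ.
suff H n a b : differentiable_upto n (fun s : R => a * cos (c * s) + b * sin (c * s)).
  split; apply/smoothP => n.
    by apply: eq_differentiable_upto (H n 1 0) => s; rewrite mul1r mul0r addr0.
  by apply: eq_differentiable_upto (H n 0 1) => s; rewrite mul1r mul0r add0r.
have dd (a' b' s : R) : is_derive s 1 (fun s : R => a' * cos (c * s) + b' * sin (c * s))
    (- (c * a') * sin (c * s) + c * b' * cos (c * s)).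
  have dc := is_derive_cosM c s; have ds := is_derive_sinM c s.
  apply: is_derive_eq.
  have sc (x y : R) : x *: (y : (R : normedModType R)) = x * y by [].
  by rewrite !sc; ring.
have df (a' b' s : R) : differentiable (fun s : R => a' * cos (c * s) + b' * sin (c * s)) s.
  by apply/derivable1_diffP; have [] := dd a' b' s.
elim: n a b => [|n IH] a b; split=> // v.
apply: eq_differentiable_upto (IH (v * (c * b)) (- (v * (c * a)))) => s.
rewrite dE //; have [_ ->] := dd a b s; ring.
Qed.

Lemma derive_entry (U : normedModType R) n1 n2 (F : U -> 'M[R]_(n1, n2)) x v i j :
  differentiable F x -> 'D_v (fun y => F y i j) x = ('D_v F x) i j.
Proof.
by move=> dF; rewrite (derive_mx (diff_derivable dF)) mxE.
Qed.

Lemma derive0_mx_cst n1 n2 (F : R -> 'M[R]_(n1, n2)) t :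
  (forall s, differentiable F s) -> (forall s, 'D_1 F s = 0) -> F t = F 0.
Proof.
move=> dF F0; apply/matrixP => i j.
apply: (is_derive_0_is_cst (f := fun s => F s i j)) => s.
have dFs : differentiable (fun y => F y i j) s.
  exact: (differentiable_comp (dF s) (differentiable_coord (F s) i j)).
apply: DeriveDef; first exact: diff_derivable.
by rewrite derive_entry // F0 mxE.
Qed.

Lemma derive_pair (U V W : normedModType R) (f : U -> V) (h : U -> W) x v :
  differentiable f x -> differentiable h x ->
  'D_v (fun y => (f y, h y)) x = ('D_v f x, 'D_v h x).
Proof.
move=> df dh; rewrite deriveE; last exact: differentiable_pair.
by rewrite diff_pair // !deriveE.
Qed.

End Curves.

(** * The integral circles of the field *)

Section Circles.
Context {R : realType} {m : nat}.
Local Notation V := ('M[R]_(m, 4) * 'rV[R]_4)%type.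
Local Notation M := (@prodM R m).
Local Notation TM := (@prodTM R m).
Variables (c : R).
Hypothesis c_gt0 : 0 < c.
Local Notation T := (fun z : V => (c *: qmul z.1 qi, 0) : V).
Implicit Types (x y : V) (s t : R).

Definition circle x t : V :=
  (cos (c * t) *: x.1 + sin (c * t) *: qmul x.1 qi, x.2).

Lemma circle0 x : circle x 0 = x.
Proof.
by rewrite /circle mulr0 cos0 sin0 scale1r scale0r addr0 -surjective_pairing.
Qed.

Lemma circleD x s t : circle (circle x s) t = circle x (s + t).
Proof.
rewrite /circle /=; congr (_, _); rewrite mulrDr cosD sinD.
rewrite qmulDl !qmulZl qmul_ii !scalerDr !scalerDl !scalerA scalerN scaleNr.
rewrite !(mulrC (cos (c * s))) !(mulrC (sin (c * s))).
by rewrite [LHS](AC (2*2) ((1*4)*(2*3))).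
Qed.

Lemma circle_sphere x t : M x -> M (circle x t).
Proof.
move=> [x1 x2]; split=> //; rewrite /sphere /= !dotDr !dotDl !dotZr !dotZl.
rewrite dot_qmul (dotC x.1 (qmul _ _)) -[dot (qmul x.1 qi) x.1]/(eta qi x.1 x.1).
have [[ii _ _ _ _] _] := @dot_units R.
rewrite eta_self ?qi0 // ii x1 !mulr0 !mulr1 addr0 add0r -!expr2.
exact: cos2Dsin2.
Qed.

Lemma circle_smooth x : smooth (circle x).
Proof.
have [sc ss] := smooth_trig c.
apply: smooth_pair; last exact: smooth_cst.
by apply: smoothD; apply: smoothZ => //; exact: smooth_cst.
Qed.

Lemma derive_circle x t : 'D_1 (circle x) t = T (circle x t).
Proof.
have dc := differentiable_cosM c t; have ds := differentiable_sinM c t.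
have d1 : differentiable (fun t : R => cos (c * t) *: x.1) t by exact: differentiableZl.
have d2 : differentiable (fun t : R => sin (c * t) *: qmul x.1 qi) t.
  exact: differentiableZl.
rewrite /circle derive_pair; [|exact: differentiableD|exact: differentiable_cst].
rewrite (deriveD_fun _ d1 d2) (deriveZ_fun _ dc (differentiable_cst _ _)).
rewrite (deriveZ_fun _ ds (differentiable_cst _ _)) !derive_cst !scaler0 !addr0.
have [_ ->] := is_derive_cosM c t; have [_ ->] := is_derive_sinM c t.
congr (_, _); rewrite /= qmulDl !qmulZl qmul_ii scalerDr !scalerA scalerN addrC mulNr.
by rewrite scaleNr.
Qed.

Lemma circle_integral_curve x : M x -> integral_curve M T (circle x).
Proof.
move=> Mx t; split; first exact: circle_sphere.
rewrite -derive_circle; apply/derivableP/smooth_derivable; exact: circle_smooth.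
Qed.

(* Rotating an integral curve back gives a curve with zero derivative. *)
Lemma integral_curve_unique (f : R -> V) t : integral_curve M T f ->
  f t = circle (f 0) t.
Proof.
move=> If.
have df s : differentiable f s by apply/derivable1_diffP; have [_ []] := If s.
have Df s : 'D_1 f s = T (f s) by have [_ []] := If s.
have df1 s : differentiable (fun s => (f s).1) s.
  apply: (differentiable_comp (df s)); apply: linear_differentiable => y.
  exact: cvg_fst.
have df2 s : differentiable (fun s => (f s).2) s.
  apply: (differentiable_comp (df s)); apply: linear_differentiable => y.
  exact: cvg_snd.
have Df1 s : 'D_1 (fun s => (f s).1) s = c *: qmul (f s).1 qi.
  rewrite (derive_linear_comp (L := fst : {linear V -> 'M[R]_(m, 4)})) ?Df //.
  by move=> y; exact: cvg_fst.
have Df2 s : 'D_1 (fun s => (f s).2) s = 0.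
  rewrite (derive_linear_comp (L := snd : {linear V -> 'rV[R]_4})) ?Df //.
  by move=> y; exact: cvg_snd.
have qN (x : 'M[R]_(m, 4)) : qmul x (- qi) = - qmul x qi.
  by rewrite -scaleN1r qmulZr scaleN1r.
have qNl (x : 'M[R]_(m, 4)) : qmul (- x) qi = - qmul x qi.
  by rewrite -scaleN1r qmulZl scaleN1r.
have dq s : differentiable (fun s => qmul (f s).1 (- qi)) s.
  have dqm : differentiable (fun x : 'M[R]_(m, 4) => qmul x (- qi)) (f s).1.
    exact/smooth_differentiable/smooth_qmul/smooth_id.
  exact: (differentiable_comp (df1 s) dqm).
(* [w s] is (f s).1 multiplied on the right by e^(-i c s). *)
pose w s := cos (c * s) *: (f s).1 + sin (c * s) *: qmul (f s).1 (- qi).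
have dw1 s : differentiable (fun s => cos (c * s) *: (f s).1) s.
  by have [] := is_diff_scale (differentiable_cosM c s) (df1 s).
have dw2 s : differentiable (fun s => sin (c * s) *: qmul (f s).1 (- qi)) s.
  by have [] := is_diff_scale (differentiable_sinM c s) (dq s).
have wE : w t = (f 0).1.
  rewrite (derive0_mx_cst (F := w)) => [|s|s].
  - by rewrite /w mulr0 cos0 sin0 scale1r scale0r addr0.
  - exact: differentiableD.
  rewrite [LHS](deriveD_fun _ (dw1 s) (dw2 s)).
  rewrite (deriveZ_fun _ (differentiable_cosM c s) (df1 s)).
  rewrite (deriveZ_fun _ (differentiable_sinM c s) (dq s)).
  rewrite (derive_qmul _ _ (df1 s)) Df1.
  have [_ ->] := is_derive_cosM c s; have [_ ->] := is_derive_sinM c s.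
  rewrite !qN !qmulZl qmul_ii !scalerN opprK !scalerA mulNr.
  by rewrite scaleNr [cos _ * c]mulrC [sin _ * c]mulrC addrA addrK addNr.
have f2 : (f t).2 = (f 0).2 by exact: (derive0_mx_cst (F := fun s => (f s).2)).
rewrite /circle -f2 -wE /w qmulDl !qmulZl qN qNl qmul_ii opprK.
rewrite [LHS]surjective_pairing; congr (_, _).
rewrite !scalerDr !scalerA scalerN (mulrC (sin _) (cos _)) addrA.
by rewrite addrNK -scalerDl -!expr2 cos2Dsin2 scale1r.
Qed.

Lemma leafE x : M x -> leaf M T x = range (circle x).
Proof.
move=> Mx; apply/seteqP; split=> [_ [f [t [If <- <-]]]|_ [t _ <-]].
  by exists t => //; rewrite -integral_curve_unique.
by exists (circle x), t; split=> //; [exact: circle_integral_curve|exact: circle0].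
Qed.

Lemma circle_neq0 x t : M x -> T (circle x t) != 0.
Proof.
move=> /(circle_sphere t) [+ _]; move: (circle x t) => y y1; apply/eqP => /(congr1 fst) /= Ty.
have [[ii _ _ _ _] _] := @dot_units R.
have := dot_qmul qi qi y.1; rewrite y1 ii mulr1.
have -> : qmul y.1 qi = 0.
  by apply/eqP; move/eqP: Ty; rewrite scaler_eq0 (gt_eqF c_gt0).
by rewrite dot0r => /esym/eqP; rewrite oner_eq0.
Qed.

Lemma generates_circles : generates_foliation M TM T.
Proof.
split.
- exact: T_field.
- by move=> x Mx; have := circle_neq0 0 Mx; rewrite circle0.
- by move=> x Mx; rewrite leafE //; exists 0 => //; exact: circle0.
- move=> x y Mx; rewrite leafE // => -[s _ <-].
  rewrite leafE; last exact: circle_sphere.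
  apply/seteqP; split=> _ [t _ <-].
    by exists (s + t) => //; rewrite circleD.
  by exists (t - s) => //; rewrite circleD addrC subrK.
Qed.

Lemma circle_period x t : circle x (t + 2 * pi / c) = circle x t.
Proof.
have e : c * (2 * pi / c) = pi *+ 2.
  by rewrite mulrC divfK ?gt_eqF // mulr_natl.
by rewrite /circle mulrDr e cosD2pi sinD2pi.
Qed.

(** From 1 - cos a = 2 sin^2 (a / 2) the sine of a / 2 vanishes, whereas it has no zero at arguments
    of absolute value strictly between 0 and pi. *)
Lemma cos_eq1 (a : R) : `|a| < pi *+ 2 -> cos a = 1 -> a = 0.
Proof.
move=> a2 ca.
have s0 : sin (a / 2) = 0.
  have a2E : a / 2 *+ 2 = a by rewrite -mulr_natr divfK.
  have := cos_mulr2n (a / 2); rewrite a2E ca cos2sin2 => h.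
  by apply/eqP; rewrite -sqrf_eq0; apply/eqP; move: h; rewrite mulr2n; lra.
have api : `|a / 2| < pi.
  by rewrite normrM [`|2^-1|]ger0_norm ?invr_ge0 // ltr_pdivrMr // mulr_natr.
apply/eqP/negPn/negP => a0.
have : 0 < sin `|a / 2|.
  by apply: sin_gt0_pi; rewrite api normr_gt0 mulf_neq0 // invr_neq0.
have [h|h] := leP 0 (a / 2); first by rewrite ger0_norm // s0 ltxx.
by rewrite ltr0_norm // sinN s0 oppr0 ltxx.
Qed.

(** Pairing with the orthonormal vectors x and x i recovers cosine and sine, so the cosine of c (s -
    t) is 1, with an argument shorter than a full turn. *)
Lemma circle_inj x : M x -> {in `[0, 2 * pi / c[ &, injective (circle x)}.
Proof.
move=> [x1 x2] s t; rewrite !in_itv /= => /andP[s0 sw] /andP[t0 tw] /(congr1 fst) /= E.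
have [[ii _ _ _ _] _] := @dot_units R.
have xx : dot x.1 (qmul x.1 qi) = 0 by rewrite dotC -[LHS]/(eta qi x.1 x.1) eta_self ?qi0.
have Ec : cos (c * s) = cos (c * t).
  by move: E => /(congr1 (dot x.1)); rewrite !dotDr !dotZr xx x1 !mulr0 !mulr1 !addr0.
have Es : sin (c * s) = sin (c * t).
  move: E => /(congr1 (dot (qmul x.1 qi))).
  by rewrite !dotDr !dotZr dot_qmul (dotC _ x.1) xx x1 ii !mulr0 !mulr1 !add0r.
apply/eqP; rewrite -subr_eq0; apply/eqP.
have : c * (s - t) = 0.
  apply: cos_eq1; last first.
    by rewrite mulrBr cosB Ec Es -!expr2 cos2Dsin2.
  rewrite normrM gtr0_norm // mulrC -ltr_pdivlMr // -mulr_natl.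
  by rewrite ltr_norml; apply/andP; split; lra.
by move/eqP; rewrite mulf_eq0 gt_eqF // => /eqP.
Qed.

Lemma closed_circle_circle x : M x ->
  closed_circle (leaf M T x) (circle x) (2 * pi / c).
Proof.
move=> Mx; split.
- split; last exact: circle_smooth.
  by rewrite divr_gt0 // mulr_gt0 // pi_gt0.
- exact: circle_period.
- exact: circle_inj.
- by move=> t; rewrite derive1E derive_circle; exact: circle_neq0.
- by rewrite leafE.
Qed.

Lemma circle_length_circle (g : V -> V -> V -> R) x :
  (forall y, M y -> g y (T y) (T y) = 1) -> M x ->
  circle_length g (circle x) (2 * pi / c) = 2 * pi / c.
Proof.
move=> gT Mx; rewrite /circle_length.
have w0 : 0 < 2 * pi / c by rewrite divr_gt0 // mulr_gt0 // pi_gt0.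
under eq_Rintegral => t _.
  rewrite derive1E derive_circle gT ?sqrtr1; last exact: circle_sphere.
  over.
rewrite Rintegral_cst //= lebesgue_measure_itv /= lte_fin w0 /=.
by rewrite mul1r subr0.
Qed.

(** By the chain rule this is the derivative of [f] along the circle, where [f] is constantly 0. *)
Lemma derive_along_circle (f : V -> R) x y : M x -> smooth f ->
  (forall z, leaf M T x z -> f z = 0) -> leaf M T x y -> 'D_(T y) f y = 0.
Proof.
move=> Mx sf f0; rewrite leafE // in f0 *; move=> -[s _ <-].
have dc t : differentiable (circle x) t by apply/smooth_differentiable/circle_smooth.
have df z : differentiable f z by exact: smooth_differentiable.
rewrite -derive_circle.
have -> : 'D_('D_1 (circle x) s) f (circle x s) = 'D_1 (f \o circle x) s.
  rewrite [RHS]deriveE; last exact: differentiable_comp.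
  by rewrite diff_comp //= -!deriveE.
rewrite (_ : f \o circle x = cst 0); first exact: derive_cst.
by apply/funext => t /=; rewrite f0 //; exists t.
Qed.

End Circles.

(** * Expansion of the metric in the forms eta *)

Section MetricE.
Context {R : realType}.
Variables (A C D p q : R).
Hypotheses (A_gt0 : 0 < A) (C_gt0 : 0 < C) (D_gt0 : 0 < D).
Let c := Num.sqrt (A * C) / 2.

Let s_neq0 : Num.sqrt (A * C) != 0.
Proof. by rewrite gt_eqF // sqrtr_gt0 mulr_gt0. Qed.

(** The eta_2-term vanishes on a field orthogonal to xi_2, and L = 1 / c. For a = i and a = k this
    gives beta_1 = eta_1 / c and beta_3 = eta_3 / c. *)
Lemma gAC_u (m : nat) (a : 'rV[R]_4) (x v : 'M[R]_(m, 4)) : dot qj a = 0 ->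
  gAC A C x (c *: xi a x) v = eta a x v / c.
Proof.
move=> ja; rewrite /gAC /xi etaZr eta_qmul ja dotZl -/(eta a x v) /c.
move: s_neq0; move: (Num.sqrt _) => s s0; field.
by rewrite s0 gt_eqF.
Qed.

Lemma sigma1E (y w : 'rV[R]_4) : sigma1 D y w = 2 / D * eta qi y w.
Proof.
rewrite /sigma1 /gS3 /vfield qmulZr dotZl -[dot (qmul y qi) w]/(eta qi y w).
by field; rewrite gt_eqF.
Qed.

Lemma metricE (m : nat) : metric (m := m) A C D p q
  = mform (c ^- 2) ((2 / A) ^+ 2 - c ^- 2) ((2 / D) ^+ 2)
      (p * (2 / D) / c) (q * (2 / D) / c).
Proof.
have [[_ _ _ ij _] jk] := @dot_units R.
apply/funext => z; apply/funext => v; apply/funext => w.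
have ji : dot qj qi = 0 :> R by rewrite dotC.
rewrite /metric /mform /beta1 /beta3 /u1 /u3 -/c !gAC_u //.
rewrite !sigma1E /gAC /gS3.
have -> : 2 / Num.sqrt (A * C) = c^-1 by rewrite /c invf_div.
by rewrite exprVn; ring.
Qed.

End MetricE.

Theorem proposition4p3 (R : realType) (m : nat) (A C D p q : R)
    (hm : (1 <= m)%N) (hC : 0 < C) (hCA : C < A) (hD : 0 < D)
    (hp : p != 0) (hq : q != 0) (hpq : p ^+ 2 + q ^+ 2 < 1) :
  let M : set ('M[R]_(m, 4) * 'rV[R]_4) := prodM (m := m) in
  let TM := prodTM (m := m) in
  let g := metric (m := m) A C D p q in
  let T := fieldT (m := m) A C in
  [/\ riemannian_metric M TM g,
      generates_foliation M TM T,
      forall x, M x -> exists (c : R -> 'M[R]_(m, 4) * 'rV[R]_4) (w : R),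
        closed_circle (leaf M T x) c w /\
        circle_length g c w = 4 * pi / Num.sqrt (A * C)
    & forall nabla, levi_civita M TM g nabla ->
        totally_geodesic_foliation M TM nabla T /\
        positive_mixed_curvature M TM g nabla T].
Proof.
have A0 : 0 < A := lt_trans hC hCA.
set c := Num.sqrt (A * C) / 2.
have c0 : 0 < c by rewrite divr_gt0 // sqrtr_gt0 mulr_gt0.
have mu0 : 0 < 2 / A by rewrite divr_gt0.
have k0 : 0 < 2 / D by rewrite divr_gt0.
(* The product is the square root of C / A. *)
have muc : 2 / A * c < 1.
  have -> : 2 / A * c = Num.sqrt (A * C) / A by rewrite /c; field; rewrite gt_eqF.
  rewrite ltr_pdivrMr // mul1r -[X in _ < X]gtr0_norm // -sqrtr_sqr ltr_sqrt ?exprn_gt0 //.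
  by rewrite expr2 ltr_pM2l.
move=> M TM g T.
have gE := metricE p q A0 hC hD m.
rewrite -[metric _ _ _ _ _]/g -/c in gE.
have gT x : M x -> g x (T x) (T x) = 1.
  move=> [x1 _]; have [[ii _ _ ij _] _] := @dot_units R.
  have e0 : eta qi x.2 0 = 0 :> R by exact: dot0r.
  rewrite gE /mform /= !dotZl !dotZr !etaZr !eta_qmul dot_qmul (dotC qj) ij ii x1 e0 dot0r.
  by rewrite !(mulr0, mul0r, addr0, mulr1) -expr2 mulVf // expf_neq0 // gt_eqF.
have TE : T = (fun z => (c *: qmul z.1 qi, 0)) by [].
have gM : riemannian_metric M TM g by rewrite gE; exact: G_riemannian.
split=> //.
- exact: generates_circles.
- move=> x Mx; exists (circle c x), (2 * pi / c).
  split; first exact: closed_circle_circle.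
  rewrite circle_length_circle // /c.
  have s0 : Num.sqrt (A * C) != 0 by rewrite gt_eqF // sqrtr_gt0 mulr_gt0.
  by field.
move=> nabla LC; rewrite gE in LC.
have vT : vector_field M TM T by exact: T_field.
split.
- move=> x Mx.
  apply: (@totally_geodesic_integral_manifold _ _ M TM _ _ _ _ _ _ LC T) => //.
  + by move=> *; exact: prodTM_linear.
  + by move=> *; exact: prodTM0.
  + exact: prod_finitely_generated.
  + by rewrite -gE.
  + move=> y My; exact: (nabla_TT c0 mu0 k0 hpq LC).
  + rewrite leafE // => _ [t _ <-]; exact: circle_sphere.
  + by rewrite -gE.
  + move=> f y sf f0 Ly; exact: (@derive_along_circle R m c f x y Mx sf f0 Ly).
- move=> X Y x vX vY Mx [a XT] X0 TY Y0.
  have aT : a != 0 by apply: contraNneq X0 => a0; rewrite XT a0 scale0r.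
  have T0 : T x != 0 by apply: contraNneq X0 => T0; rewrite XT T0 scaler0.
  rewrite gE; rewrite gE in TY.
  apply: (@mixed_sectional_curvature _ _ M TM _ _ _ _ _ _ _ _ LC T vT X Y a) => //.
  + by move=> *; exact: prodTM_linear.
  + by move=> *; exact: prodTM0.
  + exact: (smooth_derive_field (@coordf_continuous R m) (@sum_coordf R m)).
  + exact: (smooth_bracket (@coordf_continuous R m) (@sum_coordf R m)).
  + exact: prod_finitely_generated.
  + by rewrite -gE.
  + exact: (mixed_curvature_gt0 c0 mu0 k0 muc hp hq hpq LC).
Qed.
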